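(* There exist absolute constants $x_0$ and $c>0$ such that the following holds for all $x\ge x_0$. Let $(a(n))$, $\mathcal A$, $\mathcal S$, $h$, $f_q$, $\gamma_q$, $\Delta_q$, $\tilde\Delta$ be as in the context, with $0\le h(n)\le1$ for all $n$, and suppose $\mathcal S\subset[1,\log\log x]$. Let $1/100\ge\eta\ge20\log\log\log x/\log\log x$ and suppose that $z$ with $(\log x)^\eta\le z\le(\log x)/3$ is such that $$\sum_{z^{1-\eta}\le p\le z}\frac{1-h(p)}{p}\ \ge\ \eta\log\big((1-\eta)^{-1}\big).$$ Then for each $u$ with $5/\eta^2\le u\le\sqrt z$ at least one of the following statements is true: (i) For every $q\le e^{2z}$ which is composed only of primes in $[z^{1-\eta},z]$ (and so with $(q,\mathcal S)=1$) and such that $\sum_{p\mid q}(1-h(p))/p\ge\eta^2$, we have $\Delta_q(x)\ge c\,\exp(-u(1+25\eta)\log(2u/\eta^2))$. (ii) There exists $y\ge z^u$ with $\tilde\Delta(y)\ge c\,\exp(-u(1+25\eta)\log(2u/\eta^2))$.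
   Context: $(a(n))_{n\ge1}$ is a sequence of non-negative real numbers, $\mathcal A(x)=\sum_{n\le x}a(n)$ (with $\mathcal A(x)>0$) and $\mathcal A(x;q,a)=\sum_{n\le x,\ n\equiv a\,(\mathrm{mod}\ q)}a(n)$. $\mathcal S$ is a finite set of primes, and $(q,\mathcal S)=1$ means that no prime of $\mathcal S$ divides $q$. $h$ is a non-negative real-valued multiplicative function. For a positive integer $q$ put $$\gamma_q=\prod_{p\mid q}\Big(\frac{1-h(p)/p}{1-1/p}\Big)^{-1}.$$ $f_q$ is the multiplicative function defined as follows: $f_q(p^k)=1$ if $p\nmid q$; if $p^e$ (with $e\ge1$) is the exact power of $p$ dividing $q$, then $$f_q(p^k)=\Big(h(p^k)-\frac{h(p^{k+1})}{p}\Big)\Big(1-\frac{h(p)}p\Big)^{-1}\ \text{ if }k<e,\qquad f_q(p^k)=h(p^e)\Big(1-\frac1p\Big)\Big(1-\frac{h(p)}p\Big)^{-1}\ \text{ if }k\ge e.$$ Thus $f_q(a)=f_q((a,q))$, and this extends $f_q$ to all integers $a$ (with $f_q(0)=f_q(q)$). For $(q,\mathcal S)=1$, $$\Delta_q=\Delta_q(x)=\max_{x/4\le y\le x}\ \max_{a\,(\mathrm{mod}\ q)}\Big|\mathcal A(y;q,a)-\frac{f_q(a)}{q\gamma_q}\frac yx\mathcal A(x)\Big|\ \Big/\ \frac{\mathcal A(x)}{\phi(q)},$$ and $$\tilde\Delta(y)=\tilde\Delta(y,x)=\max_{(v,v+y)\subset(x/4,x)}\Big|\mathcal A(v+y)-\mathcal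 A(v)-y\frac{\mathcal A(x)}{x}\Big|\ \Big/\ y\frac{\mathcal A(x)}{x}$$ (maxima over real variables being understood as suprema). Sums and products over $p$ run over primes; $\phi$ is Euler's totient function. *)

(* Defs.v *)
From mathcomp Require Import all_boot all_order all_algebra.
From mathcomp Require Import classical_sets cardinality set_interval reals.
From mathcomp Require Import sequences exp.
Set Implicit Arguments.
Unset Strict Implicit.
Unset Printing Implicit Defensive.
Import Order.TTheory GRing.Theory Num.Theory.
Local Open Scope classical_set_scope.
Local Open Scope ring_scope.

(* Arithmetic functions on the positive integers are rendered as functions on
   [nat] whose value at 0 is never used. *)
Definition arith_multiplicative {R : realType} (g : nat -> R) : Prop :=
  g 1%N = 1 /\
  forall m n : nat, (0 < m)%N -> (0 < n)%N -> coprime m n ->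
    g (m * n)%N = g m * g n.

Definition summatory {R : realType} (a : nat -> R) (x : R) : R :=
  \sum_(1 <= n < (Num.truncn x).+1) a n.

Definition summatory_mod {R : realType} (a : nat -> R) (x : R)
    (q : nat) (b : int) : R :=
  \sum_(1 <= n < (Num.truncn x).+1 | (n%:Z == b %[mod q%:Z])%Z) a n.

Definition coprime_to_primes (S : set nat) (q : nat) : Prop :=
  forall p : nat, S p -> ~~ (p %| q)%N.

Definition gammaq {R : realType} (h : nat -> R) (q : nat) : R :=
  \prod_(p <- primes q) ((1 - h p / p%:R) / (1 - p%:R^-1))^-1.

(* [fq_pp h q p k] is the value of f_q at p ^ k, for p prime and q > 0. *)
Definition fq_pp {R : realType} (h : nat -> R) (q p k : nat) : R :=
  if ~~ (p %| q)%N then 1 else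
  let e := logn p q in
  if (k < e)%N
  then (h (p ^ k)%N - h (p ^ k.+1)%N / p%:R) * (1 - h p / p%:R)^-1
  else h (p ^ e)%N * (1 - p%:R^-1) * (1 - h p / p%:R)^-1.

Definition fq_nat {R : realType} (h : nat -> R) (q n : nat) : R :=
  \prod_(p <- primes n) fq_pp h q p (logn p n).

(* Extension to all integers through the gcd with q; it agrees with [fq_nat]
   on the positive integers by [fqE]. *)
Definition fq {R : realType} (h : nat -> R) (q : nat) (b : int) : R :=
  fq_nat h q (gcdn `|b|%N q).

(* The residue b mod q ranges over all its integer representatives. The set is
   nonempty and bounded when 0 < x and 0 < q, so [sup] is a true supremum. *)
Definition Delta {R : realType} (a : nat -> R) (h : nat -> R) (x : R)
    (q : nat) : R :=
  sup [set r : R | exists (y : R) (b : int), x / 4 <= y <= x /\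
    r = `|summatory_mod a y q b
          - fq h q b / (q%:R * gammaq h q) * (y / x) * summatory a x| ]
  / (summatory a x / (totient q)%:R).

(* For y > 3x/4 no v is admissible and, as [sup set0 = 0], the value is 0. *)
Definition tDelta {R : realType} (a : nat -> R) (x y : R) : R :=
  sup [set r : R | exists v : R,
    (`]v, v + y[ `<=` `]x / 4, x[) /\
    r = `|summatory a (v + y) - summatory a v - y * (summatory a x / x)| ]
  / (y * (summatory a x / x)).

Lemma fq_pp0 {R : realType} (h : nat -> R) (q p : nat) :
  arith_multiplicative h -> (forall n, (0 < n)%N -> 0 <= h n <= 1) ->
  (0 < q)%N -> prime p -> fq_pp h q p 0 = 1.
Proof.
move=> [h1 _] hb q0 pp; rewrite /fq_pp; case: ifP => // /negbFE pq.
rewrite logn_gt0 mem_primes pp q0 pq /= expn0 expn1 h1 divff //.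
have /andP[_ hp1] := hb p (prime_gt0 pp).
rewrite subr_eq0 eq_sym lt_eqF // ltr_pdivrMr ?ltr0n ?prime_gt0 // mul1r.
by rewrite (le_lt_trans hp1) // ltr1n prime_gt1.
Qed.

Lemma fq_nat_prime_power {R : realType} (h : nat -> R) (q p k : nat) :
  prime p -> (0 < k)%N -> fq_nat h q (p ^ k) = fq_pp h q p k.
Proof.
move=> pp k0; rewrite /fq_nat primesX // primes_prime // big_seq1.
by rewrite pfactorK.
Qed.

Lemma fq_nat_multiplicative {R : realType} (h : nat -> R) (q : nat) :
  arith_multiplicative (fq_nat h q).
Proof.
split=> [|m n m0 n0 cmn]; first by rewrite /fq_nat big_nil.
have pe : perm_eq (primes (m * n)) (primes m ++ primes n).
  apply: uniq_perm; first exact: primes_uniq.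
    rewrite cat_uniq !primes_uniq andbT /=.
    by move: cmn; rewrite coprime_has_primes.
  by move=> p; rewrite mem_cat primesM.
rewrite /fq_nat (perm_big _ pe) big_cat /=; congr (_ * _);
  apply: eq_big_seq => p; rewrite mem_primes => /and3P[pp _ pd];
  rewrite lognM //.
- by rewrite [logn p n]logn_coprime ?addn0 // (coprime_dvdl pd).
- by rewrite [logn p m]logn_coprime ?add0n // (coprime_dvdl pd) // coprime_sym.
Qed.

Lemma fqE {R : realType} (h : nat -> R) (q n : nat) :
  (0 < q)%N -> (0 < n)%N -> fq h q n%:Z = fq_nat h q n.
Proof.
move=> q0 n0; rewrite /fq /= /fq_nat.
have g0 : (0 < gcdn n q)%N by rewrite gcdn_gt0 n0.
have -> : \prod_(p <- primes n) fq_pp h q p (logn p n) =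
          \prod_(p <- primes n | (p %| q)%N) fq_pp h q p (logn p n).
  by rewrite [RHS]big_mkcond; apply: eq_bigr => p _; rewrite /fq_pp; case: (p %| q)%N.
rewrite -[RHS]big_filter.
have pe : perm_eq (primes (gcdn n q)) [seq p <- primes n | (p %| q)%N].
  apply: uniq_perm; rewrite ?filter_uniq ?primes_uniq // => p.
  rewrite mem_filter !mem_primes g0 n0 dvdn_gcd /=.
  by case: (prime p); case: (p %| n)%N; case: (p %| q)%N.
rewrite (perm_big _ pe); apply: eq_big_seq => p.
rewrite mem_filter mem_primes => /andP[pq /and3P[pp _ _]].
rewrite logn_gcd // /fq_pp pq /=.
have [le|lt] := leqP (logn p q) (logn p n).
  by rewrite ltnn.
by rewrite lt.
Qed.

(* Main.v *)
Require Import Defs.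
From HB Require Import structures.
From mathcomp Require Import all_boot all_order all_algebra.
From mathcomp Require Import classical_sets cardinality set_interval reals.
From mathcomp Require Import sequences exp.
From mathcomp Require Import all_classical all_reals all_analysis.
From mathcomp Require Import measurable_realfun.
From mathcomp Require Import ring lra zify.
Set Implicit Arguments.
Unset Strict Implicit.
Unset Printing Implicit Defensive.
Import Order.TTheory GRing.Theory Num.Theory.
Import numFieldNormedType.Exports.
Local Open Scope classical_set_scope.
Local Open Scope ring_scope.

(** Write f for f_q and gamma for gamma_q, the mean value of f. The matrix with
entries a(rq + s), where 1 <= s <= y and r runs over a dyadic range with rq
between x/4 and about x/2, is summed in two ways. Its rows are sums over short intervals,
controlled by tDelta(y); its columns are differences of sums over the
progression s mod q, controlled by Delta_q. Comparing the two totals,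
  | gamma y - sum_(s <= y) f(s) | <= gamma (1 + 8 q/phi(q)) B y
whenever both Delta_q and tDelta(y) are at most B ([maier_matrix]), and
q/phi(q) is bounded because the primes of q lie in [z^(1 - eta), z]
([sum_inv_large_primes], [ratio_totient_le]). It remains to show that the left
side cannot be small for every y in [z^u, z^(u (1 + 22 eta))]
([oscillation]).

Put g = mu * f, a function supported on the divisors of q. Since
gamma = sum_d g(d)/d, the quantity above is T(y) = sum_d g(d) {y/d}
([frac_sum_moebius_terms]). Its Mellin transform factors: with y = e^t,
  int T(e^t) e^(-(s + iw) t) dt = F(s + iw) Z(s + iw),
where F(s + iw) = sum_d g(d) d^(-(s + iw)) is a product over the primes of q
and Z is the same integral with {y} in place of T(y). In logarithmic scale
this is only the invariance of Lebesgue measure under translation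
([frac_sum_cos], [frac_sum_sin]). Let L = ln z. The frequency w = pi/L makes
p^(-iw) close to -1 for each p dividing q, so that every local factor
1 - (1 - h(p)) p^(-(s + iw)) + ... is large instead of small, and
|F(s + iw)| is at least about exp(K(s)), where
K(s) = sum_(p | q) (1 - h(p)) p^(-s) ([dir_sq_moebius_terms]). The factor Z is
at least a constant times 1/(1 - s) ([kernel_cos_lower]).

On the other side, with M(s) = sum_d |g(d)| d^(-s) <= exp(K(s) + small)
([dir_abs_moebius_terms]), changing s by 3 eta / L bounds the part of the
integral where y < z^u or y > z^(u (1 + 22 eta)) by Rankin's trick
([frac_sum_window]). Choose s so that K(s) = u (1 + 11 eta)
([saddle_point]). Then the mass of the integral sits at
t = u (1 + 11 eta) L, in the middle of the window, and the outside
contributes a proportion exp(-c eta^2 u), which is tiny because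
eta^2 u >= 5 ([gap_upper], [gap_lower]). Hence the window carries the
integral. But there |T(y)| <= e y with e a bounded multiple of
exp(-u (1 + 25 eta) ln(2u/eta^2)), and z^((1 - s) u (1 + 22 eta)) is at most
exp(u (1 + 25 eta) ln(2u/eta^2)), so the window contributes O(1/(1 - s)): a
contradiction with |F| >= exp(20). *)

(** * Elementary inequalities *)

Section ElementaryEstimates.
Context {R : realType}.

(** Squaring exp(x/2) <= 1/(1 - x/2) is what gives the sharp coefficient 1 of
x^2 on both sides of 0; the coefficient decides whether the exponents in
[gap_upper] and [gap_lower] are negative. *)
Lemma expR_le_quadratic (x : R) : x <= 1 / 3 -> expR x <= 1 + x + x ^+ 2.
Proof.
move=> x3; have x1 : 0 < 1 - x / 2 by lra.
have h : expR (x / 2) <= (1 - x / 2)^-1.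
  rewrite -[X in expR X]opprK expRN lef_pV2 ?posrE ?expR_gt0 //.
  exact: expR_ge1Dx.
rewrite [X in expR X](_ : x = x / 2 + x / 2); last by field.
rewrite expRD -expr2; apply: (@le_trans _ _ ((1 - x / 2)^-1 ^+ 2)).
  by rewrite ler_sqr ?nnegrE ?expR_ge0 // invr_ge0 ltW.
rewrite exprVn -[leLHS]mul1r ler_pdivrMr ?exprn_gt0 //.
have : 0 <= x ^+ 2 * (1 - 3 * x + x ^+ 2).
  by rewrite mulr_ge0 ?sqr_ge0 //; have := sqr_ge0 x; lra.
rewrite !exprS expr0; lra.
Qed.

Lemma truncn_divn (y : R) d : 0 <= y -> (0 < d)%N ->
  Num.truncn (y / d%:R) = (Num.truncn y %/ d)%N.
Proof.
move=> y0 d0; have dr : 0 < d%:R :> R by rewrite ltr0n.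
apply: truncn_def; rewrite ler_pdivlMr // ltr_pdivrMr // -!natrM.
have /andP[h1 h2] := truncn_itv y0; apply/andP; split.
  by apply: le_trans h1; rewrite ler_nat leq_trunc_div.
by apply: (lt_le_trans h2); rewrite ler_nat ltn_ceil.
Qed.

(** The exponent is split into four quarters to stay in the range of
[expR_le_quadratic]. *)
Lemma expR1_le3 : expR 1 <= 3 :> R.
Proof.
have h : expR (1 / 4) <= 21 / 16 :> R.
  by apply: (le_trans (expR_le_quadratic _)); lra.
rewrite (_ : 1 = 4%:R * (1 / 4) :> R); last by field.
rewrite expRM_natl; apply: (@le_trans _ _ ((21 / 16) ^+ 4)); last by rewrite !exprS expr0; lra.
by rewrite lerXn2r ?nnegrE ?expR_ge0 //; lra.
Qed.

Lemma expR_nat_le3 n : expR n%:R <= 3 ^+ n :> R.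
Proof. by rewrite -[n%:R]mulr1 expRM_natl lerXn2r ?nnegrE ?expR_ge0 ?expR1_le3. Qed.

Lemma expR_nat_ge2 n : 2 ^+ n <= expR n%:R :> R.
Proof.
rewrite -[n%:R]mulr1 expRM_natl lerXn2r ?nnegrE ?expR_ge0 //.
by have := expR_ge1Dx (1 : R); lra.
Qed.

Lemma ln_expR_le (x y : R) : expR x <= y -> x <= ln y.
Proof.
move=> h; have y0 : 0 < y by apply: lt_le_trans h; exact: expR_gt0.
by rewrite -ler_expR lnK ?posrE.
Qed.

Lemma powR_expR (z a : R) : 0 < z -> z `^ a = expR (a * ln z).
Proof. by move=> z0; rewrite -[LHS]lnK ?posrE ?powR_gt0 // ln_powR. Qed.

Lemma ler_norm_sin (x : R) : `|sin x| <= `|x|.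
Proof.
wlog x0 : x / 0 <= x => [h|].
  have [/h//|/ltW x0] := leP 0 x.
  by have := h (- x); rewrite sinN !normrN; apply; rewrite oppr_ge0.
have [c _ h] := @MVT_segment R sin cos 0 x x0 (fun c _ => is_derive_sin c)
  ltac:(by apply: continuous_subspaceT; exact: continuous_sin).
move: h; rewrite sin0 !subr0 => ->; rewrite normrM ler_piMl // ; exact: cos_max.
Qed.

(** From cos x = 1 - 2 sin^2(x/2) and |sin x| <= |x|. *)
Lemma cos_ge_quadratic (x : R) : 1 - x ^+ 2 / 2 <= cos x.
Proof.
rewrite (_ : x = (x / 2) *+ 2); last by rewrite -mulr_natr; field.
rewrite cos_mulr2n cos2sin2; move: (x / 2) => y.
have : sin y ^+ 2 <= y ^+ 2.
  rewrite -[leLHS]real_normK ?num_real // -[leRHS]real_normK ?num_real //.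
  by rewrite lerXn2r ?nnegrE // ler_norm_sin.
rewrite (_ : (y *+ 2) ^+ 2 / 2 = 2 * y ^+ 2); last by rewrite mulr2n; field.
by rewrite mulr2n; lra.
Qed.

Lemma cos_ge_linear (x : R) : 0 <= x -> 1 - x <= cos x.
Proof.
move=> x0; have := cos_geN1 x; have := cos_ge_quadratic x.
have [h|h] := leP x 2; last lra.
by nra.
Qed.

(** The last step of the oscillation argument: C is |F|^2, b is 1 - s, and
1/(10 b) is a lower bound for the transform of the fractional part. *)
Lemma mass_comparison (G b C J : R) : 0 < G -> 0 < b -> G ^+ 2 <= C ->
  0 <= J <= G * (3 / 100) / b -> C * (1 / (10 * b)) ^+ 2 <= 2 * J ^+ 2 -> False.
Proof.
move=> G0 b0 hC /andP[J0 hJ] hCJ.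
have : G ^+ 2 * (1 / (10 * b)) ^+ 2 <= 2 * (G * (3 / 100) / b) ^+ 2.
  apply: le_trans (le_trans hCJ _); first by rewrite ler_wpM2r ?sqr_ge0.
  by rewrite ler_wpM2l // ler_sqr ?nnegrE // (le_trans J0).
rewrite (_ : G ^+ 2 * (1 / (10 * b)) ^+ 2 = (G / b) ^+ 2 / 100); last by field; lra.
rewrite (_ : 2 * (G * (3 / 100) / b) ^+ 2 = (G / b) ^+ 2 * (18 / (100 * 100))); last by field; lra.
have : 0 < (G / b) ^+ 2 by rewrite exprn_gt0 // divr_gt0.
lra.
Qed.

End ElementaryEstimates.

(** * Mellin transforms of sums of fractional parts *)

Section FractionalSums.
Context {R : realType}.
Notation mu := (@lebesgue_measure R).

(** Translations are typed as maps of the measurable real line so that they can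
be packaged as measurable functions and used in image measures. *)
Definition translate (l : R) : measurableTypeR R -> measurableTypeR R :=
  fun t => t - l.

Lemma measurable_translate l : measurable_fun setT (translate l).
Proof. by apply: measurable_funB. Qed.

HB.instance Definition _ l :=
  isMeasurableFun.Build _ _ _ _ (translate l) (measurable_translate l).

Lemma lebesgue_measure_shift (l : R) (A : set R) : measurable A ->
  pushforward mu (translate l) A = mu A.
Proof.
move=> mA; apply/esym.
apply: (lebesgue_measure_unique (mu := pushforward mu (translate l))) => //= _ [[a b]] _ <-.
rewrite /pushforward.
have -> : translate l @^-1` `]a, b] = `]a + l, b + l]%classic.
  by apply/seteqP; split=> t; rewrite /translate /= !in_itv/= ltrBrDr lerBlDr.
rewrite !lebesgue_measure_itv/= !lte_fin ltrD2r -!EFinD; case: ifP => // _.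
by congr EFin; ring.
Qed.

(** Integrability and value travel together through sums, scalings and
translations, which avoids repeating the integrability side conditions. *)
Definition has_integral (f : R -> R) (I : R) :=
  mu.-integrable setT (EFin \o f) /\ (\int[mu]_t f t = I)%R.

Lemma has_integral_shift (l : R) (f : R -> R) (I : R) :
  has_integral f I -> has_integral (fun t => f (t - l)) I.
Proof.
move=> [fi <-].
have [mfi foo] := integrableP _ _ _ fi.
have E (h : R -> \bar R) :
    (\int[mu]_t h t = \int[pushforward mu (translate l)]_t h t)%E.
  by apply: eq_measure_integral => A mA _; exact/esym/lebesgue_measure_shift.
have fi' : mu.-integrable setT (EFin \o (fun t => f (t - l))).
  apply/integrableP; split.
    exact: (measurableT_comp mfi (measurable_translate l)).
  move: foo; rewrite E ge0_integral_pushforward //=.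
  exact: (measurableT_comp (@abse_measurable _ setT) mfi).
split => //; rewrite /Rintegral; congr fine.
by rewrite [RHS]E integral_pushforward.
Qed.

(** The two halves of the envelope of {e^t} e^(-st): {y} <= y is used for
y < 1 and {y} <= 1 for y >= 1. *)
Definition left_exp (a : R) : R -> R := (fun t => expR (a * t)) \_ `]-oo, 0[.
Definition right_exp (b : R) : R -> R := (fun t => expR (- (b * t))) \_ `[0, +oo[.

Lemma left_expE a t : left_exp a t = if t < 0 then expR (a * t) else 0.
Proof.
rewrite /left_exp patchE; case: ifPn; first by rewrite inE /= in_itv/= => ->.
by rewrite notin_setE /= in_itv/= => /negP/negbTE ->.
Qed.

Lemma right_expE b t : right_exp b t = if 0 <= t then expR (- (b * t)) else 0.
Proof.
rewrite /right_exp patchE; case: ifPn; first by rewrite inE /= in_itv/= andbT => ->.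
by rewrite notin_setE /= in_itv/= andbT => /negP/negbTE ->.
Qed.

Lemma measurable_expRl (a : R) D : measurable_fun D (fun t : R => expR (a * t)).
Proof.
apply: measurable_funTS; apply: (measurableT_comp (@measurable_expR R)).
by apply: measurable_funM.
Qed.

Lemma integral_right_exp b : 0 < b -> (\int[mu]_t (right_exp b t)%:E = b^-1%:E)%E.
Proof.
move=> b0; have bi : (0 <= b^-1%:E :> \bar R)%E by rewrite lee_fin invr_ge0 ltW.
rewrite -[RHS]mule1 -(integral_exponential_pdf b0) -ge0_integralZl //; first last.
- by move=> t _; rewrite lee_fin exponential_pdf_ge0 // ltW.
- by apply/measurable_EFinP; exact: measurable_exponential_pdf.
apply: eq_integral => t _; rewrite -EFinM; congr EFin.
rewrite right_expE; case: ifPn => t0; first by rewrite exponential_pdfE // mulrA mulVf ?gt_eqF // mul1r mulNr.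
by rewrite lt0_exponential_pdf ?mulr0 // ltNge.
Qed.

Lemma integral_left_exp a : 0 < a -> (\int[mu]_t (left_exp a t)%:E = a^-1%:E)%E.
Proof.
move=> a0; rewrite -(integral_right_exp a0).
have E (f : R -> R) D : (\int[mu]_t ((f \_ D) t)%:E = \int[mu]_(t in D) (f t)%:E)%E.
  by rewrite [RHS]integral_mkcond; apply: eq_integral => t _; rewrite restrict_EFin.
rewrite /left_exp /right_exp !E.
rewrite integral_itv_bndo_bndc; last by apply/measurable_EFinP; exact: measurable_expRl.
rewrite ge0_integration_by_substitution0; first last.
- by move=> r; rewrite lee_fin expR_ge0.
- apply/measurable_EFinP.
  rewrite (_ : (fun t => _) = (fun t => expR (- a * t))); first exact: measurable_expRl.
  by apply/funext => t; rewrite mulNr.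
by apply: eq_integral => t _; rewrite /= mulrN opprK.
Qed.

Lemma has_integral_ge0 (f : R -> R) (I : R) :
  measurable_fun setT f -> (forall t, 0 <= f t) ->
  (\int[mu]_t (f t)%:E = I%:E)%E ->
  has_integral f I.
Proof.
move=> mf f0 fI; split; last by rewrite /Rintegral fI.
apply/integrableP; split; first exact/measurable_EFinP.
under eq_integral => t _ do rewrite /= ger0_norm //.
by rewrite fI ltry.
Qed.

Lemma has_integral_right_exp b : 0 < b -> has_integral (right_exp b) b^-1.
Proof.
move=> b0; apply: has_integral_ge0; last exact: integral_right_exp.
  apply/measurable_restrict => //.
  rewrite (_ : (fun t => _) = (fun t => expR (- b * t))); first exact: measurable_expRl.
  by apply/funext => t; rewrite mulNr.
by move=> t; rewrite right_expE; case: ifP => // _; exact: expR_ge0.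
Qed.

Lemma has_integral_left_exp a : 0 < a -> has_integral (left_exp a) a^-1.
Proof.
move=> a0; apply: has_integral_ge0; last exact: integral_left_exp.
  by apply/measurable_restrict => //; exact: measurable_expRl.
by move=> t; rewrite left_expE; case: ifP => // _; exact: expR_ge0.
Qed.

Definition frac_part (y : R) : R := y - (Num.truncn y)%:R.

Lemma frac_part_bounds y : 0 <= y -> [/\ 0 <= frac_part y, frac_part y <= y & frac_part y <= 1].
Proof.
move=> y0; have /andP[h1 h2] := truncn_itv y0; rewrite /frac_part; split.
- by rewrite subr_ge0.
- by rewrite lerBlDr lerDl.
- by rewrite lerBlDr addrC natr1 ltW.
Qed.

Lemma frac_part_small y : 0 <= y < 1 -> frac_part y = y.
Proof.
move=> /andP[y0 y1]; have /andP[h1 _] := truncn_itv y0.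
have : ((Num.truncn y)%:R < 1%:R :> R) by exact: le_lt_trans h1 y1.
by rewrite ltr_nat ltnS leqn0 /frac_part => /eqP ->; rewrite subr0.
Qed.

Lemma measurable_frac_part_expR : measurable_fun setT (fun t : R => frac_part (expR t)).
Proof.
apply: measurable_funB; first exact: measurable_expR.
apply: nondecreasing_measurable => // s t st.
by rewrite ler_nat; apply: le_truncn; rewrite ler_expR.
Qed.

Definition exp_hull (s t : R) := left_exp (1 - s) t + right_exp s t.

Lemma exp_hullE s t : exp_hull s t = if t < 0 then expR ((1 - s) * t) else expR (- (s * t)).
Proof. by rewrite /exp_hull left_expE right_expE leNgt; case: ifP => _ /=; rewrite ?addr0 ?add0r. Qed.

Lemma frac_part_le_hull s t : frac_part (expR t) * expR (- (s * t)) <= exp_hull s t.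
Proof.
rewrite exp_hullE; have [_ h1 h2] := frac_part_bounds (expR_ge0 t); case: ifP => t0.
  rewrite (_ : (1 - s) * t = t + - (s * t)); last by ring.
  by rewrite expRD ler_wpM2r ?expR_ge0.
by rewrite -[leRHS]mul1r ler_wpM2r ?expR_ge0.
Qed.

Lemma has_integralD (f g : R -> R) (I J : R) :
  has_integral f I -> has_integral g J ->
  has_integral (fun t => f t + g t) (I + J).
Proof.
move=> [fi fI] [gi gI]; split; last by rewrite RintegralD // fI gI.
have := integrableD measurableT fi gi.
by apply: eq_integrable => // t _.
Qed.

Lemma has_integralZ (f : R -> R) (I k : R) :
  has_integral f I -> has_integral (fun t => k * f t) (k * I).
Proof.
move=> [fi fI]; split; last by rewrite RintegralZl // fI.
have := integrableZl measurableT k fi.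
by apply: eq_integrable => // t _.
Qed.

Lemma has_integral_sum (A : Type) (r : seq A) (f : A -> R -> R) (I : A -> R) :
  (forall i, has_integral (f i) (I i)) ->
  has_integral (fun t => \sum_(i <- r) f i t) (\sum_(i <- r) I i).
Proof.
move=> h; elim: r => [|i r [IH1 IH2]].
  rewrite big_nil.
  have E : (fun t : R => \sum_(i <- [::]) f i t) = cst 0.
    by apply/funext => t; rewrite big_nil.
  split; first by rewrite E; apply: (integrable0 _ _).
  by under eq_Rintegral => t _ do rewrite big_nil; rewrite Rintegral_cst // mul0r.
have -> : (fun t => \sum_(j <- i :: r) f j t) = (fun t => f i t + \sum_(j <- r) f j t).
  by apply/funext => t; rewrite big_cons.
by rewrite big_cons; apply: has_integralD.
Qed.

Lemma has_integral_hull s : 0 < s < 1 ->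
  has_integral (exp_hull s) ((1 - s)^-1 + s^-1).
Proof.
move=> /andP[s0 s1]; apply: has_integralD; last exact: has_integral_right_exp.
by apply: has_integral_left_exp; rewrite subr_gt0.
Qed.

Lemma dominated_integrable (f g : R -> R) : measurable_fun setT f ->
  mu.-integrable setT (EFin \o g) -> (forall t, `|f t| <= g t) ->
  mu.-integrable setT (EFin \o f).
Proof.
move=> mf gi fg; apply: (le_integrable measurableT _ _ gi).
  exact/measurable_EFinP.
by move=> t _ /=; rewrite lee_fin (le_trans (fg t)) // ler_norm.
Qed.

(** Real part of {e^t} e^(-(s + iw)t), and minus its imaginary part. Complex
numbers are avoided throughout by carrying cosine and sine transforms. *)
Definition kernel_cos (s w t : R) := frac_part (expR t) * expR (- (s * t)) * cos (w * t).
Definition kernel_sin (s w t : R) := frac_part (expR t) * expR (- (s * t)) * sin (w * t).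

Lemma frac_exp_ge0 s t : 0 <= frac_part (expR t) * expR (- (s * t)).
Proof. by rewrite mulr_ge0 ?expR_ge0 //; have [] := frac_part_bounds (expR_ge0 t). Qed.

Lemma measurable_frac_exp s :
  measurable_fun setT (fun t : R => frac_part (expR t) * expR (- (s * t))).
Proof.
apply: measurable_funM; first exact: measurable_frac_part_expR.
rewrite (_ : (fun t => _) = (fun t => expR (- s * t))); first exact: measurable_expRl.
by apply/funext => t; rewrite mulNr.
Qed.

Lemma kernel_cos_integrable s w : 0 < s < 1 -> mu.-integrable setT (EFin \o kernel_cos s w).
Proof.
move=> hs; apply: (dominated_integrable _ (has_integral_hull hs).1).
  apply: measurable_funM; first exact: measurable_frac_exp.
  apply: (measurableT_comp (f := cos)); last exact: measurable_funM.
  by apply: continuous_measurable_fun; exact: continuous_cos.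
move=> t; rewrite /kernel_cos normrM ger0_norm ?frac_exp_ge0 //.
by apply: le_trans (frac_part_le_hull s t); rewrite ler_piMr ?frac_exp_ge0 ?cos_max.
Qed.

Lemma kernel_sin_integrable s w : 0 < s < 1 -> mu.-integrable setT (EFin \o kernel_sin s w).
Proof.
move=> hs; apply: (dominated_integrable _ (has_integral_hull hs).1).
  apply: measurable_funM; first exact: measurable_frac_exp.
  apply: (measurableT_comp (f := sin)); last exact: measurable_funM.
  by apply: continuous_measurable_fun; exact: continuous_sin.
move=> t; rewrite /kernel_sin normrM ger0_norm ?frac_exp_ge0 //.
by apply: le_trans (frac_part_le_hull s t); rewrite ler_piMr ?frac_exp_ge0 ?sin_max.
Qed.

Implicit Type D : seq (R * R).

(** A list of pairs (l, c) stands for the discrete measure with mass c at l;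
for l = ln d the sum below is sum c {y/d} at y = e^t. *)
Definition frac_sum D (t : R) := \sum_(i <- D) i.2 * frac_part (expR (t - i.1)).
(** Real part of F(s + iw) = sum c e^(-(s + iw) l), minus its imaginary part,
and the sum of absolute values. *)
Definition dir_cos D (s w : R) := \sum_(i <- D) i.2 * expR (- (s * i.1)) * cos (w * i.1).
Definition dir_sin D (s w : R) := \sum_(i <- D) i.2 * expR (- (s * i.1)) * sin (w * i.1).
Definition dir_abs D (s : R) := \sum_(i <- D) `|i.2| * expR (- (s * i.1)).

(** Real part of the factorisation of the transform into F times Z: each term
of the sum is a translate, and Lebesgue measure is translation invariant. *)
Lemma frac_sum_cos D s w : 0 < s < 1 ->
  has_integral (fun t => frac_sum D t * expR (- (s * t)) * cos (w * t))
   (dir_cos D s w * \int[mu]_t kernel_cos s w t - dir_sin D s w * \int[mu]_t kernel_sin s w t)%R.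
Proof.
move=> hs; have kc := kernel_cos_integrable w hs; have ks := kernel_sin_integrable w hs.
have step (i : R * R) := has_integralD
  (has_integralZ (i.2 * expR (- (s * i.1)) * cos (w * i.1)) (has_integral_shift i.1 (conj kc erefl)))
  (has_integralZ (- (i.2 * expR (- (s * i.1)) * sin (w * i.1))) (has_integral_shift i.1 (conj ks erefl))).
have [h1 h2] := has_integral_sum D step.
have E : (fun t => frac_sum D t * expR (- (s * t)) * cos (w * t)) =
  (fun t => \sum_(i <- D) (i.2 * expR (- (s * i.1)) * cos (w * i.1) * kernel_cos s w (t - i.1)
     + - (i.2 * expR (- (s * i.1)) * sin (w * i.1)) * kernel_sin s w (t - i.1))).
  apply/funext => t; rewrite /frac_sum !mulr_suml; apply: eq_bigr => i _.
  rewrite (_ : w * t = w * i.1 + w * (t - i.1)); last by ring.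
  rewrite cosD (_ : - (s * t) = - (s * i.1) + - (s * (t - i.1))); last by ring.
  by rewrite [expR (- (s * i.1) + _)]expRD /kernel_cos /kernel_sin; ring.
rewrite E; split => //; rewrite h2 big_split /= -mulr_suml /dir_cos /dir_sin; congr (_ + _).
by rewrite -mulr_suml sumrN mulNr.
Qed.

(** Imaginary part of the same factorisation. *)
Lemma frac_sum_sin D s w : 0 < s < 1 ->
  has_integral (fun t => frac_sum D t * expR (- (s * t)) * sin (w * t))
   (dir_sin D s w * \int[mu]_t kernel_cos s w t + dir_cos D s w * \int[mu]_t kernel_sin s w t)%R.
Proof.
move=> hs; have kc := kernel_cos_integrable w hs; have ks := kernel_sin_integrable w hs.
have step (i : R * R) := has_integralD
  (has_integralZ (i.2 * expR (- (s * i.1)) * sin (w * i.1)) (has_integral_shift i.1 (conj kc erefl)))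
  (has_integralZ (i.2 * expR (- (s * i.1)) * cos (w * i.1)) (has_integral_shift i.1 (conj ks erefl))).
have [h1 h2] := has_integral_sum D step.
have E : (fun t => frac_sum D t * expR (- (s * t)) * sin (w * t)) =
  (fun t => \sum_(i <- D) (i.2 * expR (- (s * i.1)) * sin (w * i.1) * kernel_cos s w (t - i.1)
     + i.2 * expR (- (s * i.1)) * cos (w * i.1) * kernel_sin s w (t - i.1))).
  apply/funext => t; rewrite /frac_sum !mulr_suml; apply: eq_bigr => i _.
  rewrite (_ : w * t = w * i.1 + w * (t - i.1)); last by ring.
  rewrite sinD (_ : - (s * t) = - (s * i.1) + - (s * (t - i.1))); last by ring.
  by rewrite [expR (- (s * i.1) + _)]expRD /kernel_cos /kernel_sin; ring.
by rewrite E; split => //; rewrite h2 big_split /= -!mulr_suml /dir_cos /dir_sin.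
Qed.

Lemma measurable_frac_sum D : measurable_fun setT (frac_sum D).
Proof.
elim: D => [|i D IH].
  rewrite (_ : frac_sum _ = cst 0) //; apply/funext => t.
  by rewrite /frac_sum big_nil.
rewrite (_ : frac_sum _ = (fun t => i.2 * frac_part (expR (t - i.1)) + frac_sum D t)).
  apply: measurable_funD => //; apply: measurable_funM => //.
  exact: (measurableT_comp measurable_frac_part_expR (measurable_translate i.1)).
by apply/funext => t; rewrite /frac_sum big_cons.
Qed.

Lemma frac_sum_abs D s : 0 < s < 1 ->
  mu.-integrable setT (EFin \o (fun t => `|frac_sum D t| * expR (- (s * t)))) /\
  (\int[mu]_t (`|frac_sum D t| * expR (- (s * t))) <=
   dir_abs D s * ((1 - s)^-1 + s^-1))%R.
Proof.
move=> hs.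
have step (i : R * R) := has_integralZ (`|i.2| * expR (- (s * i.1))) (has_integral_shift i.1 (has_integral_hull hs)).
have [h1 h2] := has_integral_sum D step.
have le t : `|frac_sum D t| * expR (- (s * t)) <=
    \sum_(i <- D) `|i.2| * expR (- (s * i.1)) * exp_hull s (t - i.1).
  apply: (le_trans (ler_wpM2r (expR_ge0 _) (ler_norm_sum _ _ _))).
  rewrite mulr_suml; apply: ler_sum => i _.
  rewrite normrM (ger0_norm (_ : 0 <= frac_part _)); last first.
    by have [] := frac_part_bounds (expR_ge0 (t - i.1)).
  rewrite (_ : - (s * t) = - (s * i.1) + - (s * (t - i.1))); last by ring.
  rewrite [expR (- (s * i.1) + _)]expRD -!mulrA ler_wpM2l // mulrCA ler_wpM2l ?expR_ge0 //.
  exact: frac_part_le_hull.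
have int : mu.-integrable setT (EFin \o (fun t => `|frac_sum D t| * expR (- (s * t)))).
  apply: (dominated_integrable _ h1) => [|t]; last first.
    by rewrite ger0_norm // mulr_ge0 ?expR_ge0.
  apply: measurable_funM.
    by apply: (measurableT_comp (f := @Num.norm _ R)) => //; exact: measurable_frac_sum.
  rewrite (_ : (fun t => _) = (fun t => expR (- s * t))); first exact: measurable_expRl.
  by apply/funext => t; rewrite mulNr.
split => //; rewrite /dir_abs mulr_suml -h2.
by apply: le_Rintegral => // t _; exact: le.
Qed.

(** Rankin's trick. Outside the window e^(-st) is at most e^((s1 - s) v1) e^(-s1 t)
to the right of v1 and e^((s2 - s) v0) e^(-s2 t) to the left of v0, so both tails
are bounded by full integrals with the exponents s1 and s2. No factor depending
on s - s1 or s2 - s is lost, which matters since these gaps are far smaller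
than 1 - s. *)
Lemma frac_sum_window D (s s1 s2 v0 v1 e : R) :
  0 < s1 -> s1 < s -> s < s2 -> s2 < 1 -> 0 <= e ->
  (forall t, v0 <= t <= v1 -> `|frac_sum D t| <= e * expR t) ->
  (\int[mu]_t (`|frac_sum D t| * expR (- (s * t))) <=
   e * expR ((1 - s) * v1) / (1 - s)
   + expR ((s1 - s) * v1) * (dir_abs D s1 * ((1 - s1)^-1 + s1^-1))
   + expR ((s2 - s) * v0) * (dir_abs D s2 * ((1 - s2)^-1 + s2^-1)))%R.
Proof.
move=> s10 s1s ss2 s21 e0 hT.
have b0 : 0 < 1 - s by lra.
have [i0 _] := @frac_sum_abs D s ltac:(lra).
have [i1 h1] := @frac_sum_abs D s1 ltac:(lra).
have [i2 h2] := @frac_sum_abs D s2 ltac:(lra).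
have [j hj] := has_integralD (has_integralD
  (has_integralZ (e * expR ((1 - s) * v1)) (has_integral_shift v1 (has_integral_left_exp b0)))
  (has_integralZ (expR ((s1 - s) * v1)) (conj i1 erefl)))
  (has_integralZ (expR ((s2 - s) * v0)) (conj i2 erefl)).
apply: (le_trans (le_Rintegral measurableT i0 j _)); last first.
  by rewrite hj !lerD // ler_wpM2l ?expR_ge0.
move=> t _; clear hj j i0 i1 i2 h1 h2; set N := left_exp _ _.
have N0 : 0 <= N by rewrite /N left_expE; case: ifP => // _; exact: expR_ge0.
have A0 : 0 <= e * expR ((1 - s) * v1) * N by rewrite !mulr_ge0 ?expR_ge0.
have B0 s' v : 0 <= expR ((s' - s) * v) * (`|frac_sum D t| * expR (- (s' * t))).
  by rewrite !mulr_ge0 ?expR_ge0.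
have key s' v : 0 <= (s' - s) * (v - t) ->
    `|frac_sum D t| * expR (- (s * t)) <= expR ((s' - s) * v) * (`|frac_sum D t| * expR (- (s' * t))).
  move=> h; rewrite mulrCA ler_wpM2l // -expRD ler_expR; lra.
have [t0|t0] := ltP t v0.
  apply: (le_trans (key s2 v0 _)); first by rewrite mulr_ge0 //; lra.
  by rewrite lerDr addr_ge0.
have [t1|t1] := ltP t v1; last first.
  apply: (le_trans (key s1 v1 _)); first by rewrite mulr_le0 //; lra.
  by rewrite -addrA addrCA lerDl addr_ge0.
rewrite -addrA; apply: (@le_trans _ _ (e * expR ((1 - s) * v1) * N)); last by rewrite lerDl addr_ge0.
rewrite /N left_expE subr_lt0 t1 -mulrA -expRD.
apply: (le_trans (ler_wpM2r (expR_ge0 _) (hT t _))); first by rewrite t0 ltW.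
rewrite -mulrA -expRD ler_wpM2l // ler_expR; lra.
Qed.

(** For t < 0 the fractional part is e^t itself and the integral is explicit up
to the oscillation of the cosine; for t >= 0 the integrand is nonnegative until
w t = pi/2, and what follows is exponentially small. *)
Lemma kernel_cos_lower (s w : R) : 0 < s < 1 -> 0 < w -> w < 1 - s ->
  (2 / (1 - s) - (1 - s - w)^-1 - 2 * expR (- (s * pi / (4 * w))) / s <=
   \int[mu]_t kernel_cos s w t)%R.
Proof.
move=> /andP[s0 s1] w0 ws.
have b0 : 0 < 1 - s by lra.
have c0 : 0 < 1 - s - w by lra.
have d0 : 0 < s / 2 by lra.
set q := expR (- (s * pi / (4 * w))).
have [j hj] := has_integralD (has_integralD (has_integralZ 2 (has_integral_left_exp b0)) (has_integralZ (-1) (has_integral_left_exp c0)))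
  (has_integralZ (- q) (has_integral_right_exp d0)).
have hs : 0 < s < 1 by lra.
apply: (le_trans _ (le_Rintegral measurableT j (kernel_cos_integrable w hs) _)).
  by rewrite hj invf_div; lra.
move=> t _; clear hj j; rewrite !left_expE right_expE [0 <= t]leNgt; case: ifPn => t0 /=.
  rewrite mulr0 addr0 /kernel_cos frac_part_small; last by rewrite expR_ge0 expR_lt1.
  rewrite -expRD (_ : t + - (s * t) = (1 - s) * t); last by ring.
  rewrite (_ : (1 - s - w) * t = (1 - s) * t + - (w * t)); last by ring.
  rewrite expRD; apply: (@le_trans _ _ (expR ((1 - s) * t) * (2 - expR (- (w * t))))).
    by lra.
  rewrite ler_wpM2l ?expR_ge0 //.
  have x0 : 0 <= - (w * t) by rewrite -mulrN mulr_ge0 //; lra.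
  rewrite -cosN; move: (- (w * t)) x0 => x x0.
  have h : 1 + x <= expR x by exact: expR_ge1Dx.
  have := cos_ge_linear x0; lra.
rewrite -leNgt in t0.
rewrite !mulr0 !add0r mulNr lerNl.
have [tb|tb] := leP (w * t) (pi / 2).
  apply: (@le_trans _ _ 0); last by rewrite mulr_ge0 ?expR_ge0.
  rewrite oppr_le0 mulr_ge0 ?frac_exp_ge0 // cos_ge0_pihalf //.
  have p0 := pi_gt0 R; have wt0 : 0 <= w * t by rewrite mulr_ge0 // ltW.
  by rewrite tb andbT; lra.
(* Beyond w t = pi/2 half of the exponential decay is spent on the factor q. *)
apply: (@le_trans _ _ (expR (- (s * t)))).
  rewrite /kernel_cos -mulrN; have [_ _ h2] := frac_part_bounds (expR_ge0 t).
  apply: (@le_trans _ _ (frac_part (expR t) * expR (- (s * t)))).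
    by rewrite ler_piMr ?frac_exp_ge0 // lerNl cos_geN1.
  by rewrite ler_piMl ?expR_ge0.
rewrite /q -expRD ler_expR.
rewrite (_ : s * pi / (4 * w) = s / 2 * ((pi / 2) / w)); last by field; lra.
have : pi / 2 / w <= t by rewrite ler_pdivrMr // [t * w]mulrC ltW.
move/(ler_wpM2l (ltW d0)). lra.
Qed.

(** The factorisation says that the squared modulus of the transform is
|F|^2 |Z|^2, and |Z| is at least its real part; the cosine and sine transforms
are both bounded by the absolute integral, whence the factor 2. *)
Lemma transform_le_window D (s s1 s2 w v0 v1 e Z : R) :
  0 < s1 -> s1 < s -> s < s2 -> s2 < 1 -> 0 <= e -> 
  (forall t, v0 <= t <= v1 -> `|frac_sum D t| <= e * expR t) ->
  0 <= Z -> (Z <= \int[mu]_t kernel_cos s w t)%R ->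
  (dir_cos D s w ^+ 2 + dir_sin D s w ^+ 2) * Z ^+ 2 <=
  2 * (e * expR ((1 - s) * v1) / (1 - s)
   + expR ((s1 - s) * v1) * (dir_abs D s1 * ((1 - s1)^-1 + s1^-1))
   + expR ((s2 - s) * v0) * (dir_abs D s2 * ((1 - s2)^-1 + s2^-1))) ^+ 2.
Proof.
move=> s10 s1s ss2 s21 e0 hT Z0 hZ.
have hs : 0 < s < 1 by lra.
have hJ := frac_sum_window s10 s1s ss2 s21 e0 hT; set J := (X in 2 * X ^+ 2); rewrite -/J in hJ.
have [ic hc] := frac_sum_cos D w hs; have [is_ hsn] := frac_sum_sin D w hs.
have [ia _] := frac_sum_abs D hs.
have bound (f : R -> R) (g : R -> R) : (forall t, `|g t| <= 1) ->
   (forall t, f t = frac_sum D t * expR (- (s * t)) * g t) ->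
   mu.-integrable setT (EFin \o f) -> (`|\int[mu]_t f t| <= J)%R.
  move=> hg hf fi; apply: le_trans hJ; apply: (le_trans (le_normr_Rintegral measurableT fi)).
  apply: le_Rintegral => //; first exact: integrable_norm.
  move=> t _; rewrite hf normrM normrM (ger0_norm (expR_ge0 _)).
  by rewrite ler_piMr // mulr_ge0 ?expR_ge0.
have hX : (`|\int[mu]_t (frac_sum D t * expR (- (s * t)) * cos (w * t))| <= J)%R.
  by apply: (bound _ (fun t => cos (w * t))) => // t; exact: cos_max.
have hY : (`|\int[mu]_t (frac_sum D t * expR (- (s * t)) * sin (w * t))| <= J)%R.
  by apply: (bound _ (fun t => sin (w * t))) => // t; exact: sin_max.
rewrite hc in hX; rewrite hsn in hY.
move: (dir_cos D s w) (dir_sin D s w) hX hY => C S.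
move: (\int[mu]_t kernel_cos s w t)%R (\int[mu]_t kernel_sin s w t)%R hZ => Zc Zs hZ hX hY.
have J0 : 0 <= J by exact: le_trans hX.
have sq (x : R) : `|x| <= J -> x ^+ 2 <= J ^+ 2.
  by move=> h; rewrite -[x ^+ 2]real_normK ?num_real // lerXn2r ?nnegrE.
have := sq _ hX; have := sq _ hY => h1 h2.
apply: (@le_trans _ _ ((C ^+ 2 + S ^+ 2) * Zc ^+ 2)).
  by rewrite ler_wpM2l ?addr_ge0 ?sqr_ge0 // lerXn2r ?nnegrE // (le_trans Z0).
apply: (@le_trans _ _ ((C ^+ 2 + S ^+ 2) * (Zc ^+ 2 + Zs ^+ 2))).
  by rewrite ler_wpM2l ?addr_ge0 ?sqr_ge0 // lerDl sqr_ge0.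
rewrite [leLHS](_ : _ = (C * Zc - S * Zs) ^+ 2 + (S * Zc + C * Zs) ^+ 2); last by ring.
by rewrite mulr_natl mulr2n lerD.
Qed.

End FractionalSums.

(** * The Moebius transform of f_q as a product over primes *)

Section Divisors.
Context {R : realType}.
Implicit Types (L : seq (nat * R)) (D : seq (R * R)).

(** Passage from multiplicative data, terms g(d) indexed by d, to the additive
data of the previous part, indexed by ln d. *)
Definition log_terms L : seq (R * R) := [seq (ln x.1%:R, x.2) | x <- L].

(** Convolution of discrete measures, in additive and in multiplicative
notation. *)
Definition shift_mul D1 D2 : seq (R * R) := [seq (x.1 + y.1, x.2 * y.2) | x <- D1, y <- D2].

Definition term_mul L1 L2 : seq (nat * R) := [seq ((x.1 * y.1)%N, x.2 * y.2) | x <- L1, y <- L2].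

Definition pos_terms L := all (fun x : nat * R => (0 < x.1)%N) L.

Lemma pos_term_mul L1 L2 : pos_terms L1 -> pos_terms L2 -> pos_terms (term_mul L1 L2).
Proof.
move=> h1 h2; apply/allP => z /allpairsP[[x y] /= [xi yi ->]] /=.
by rewrite muln_gt0 (allP h1 _ xi) (allP h2 _ yi).
Qed.

Lemma log_terms_mul L1 L2 : pos_terms L1 -> pos_terms L2 ->
  log_terms (term_mul L1 L2) = shift_mul (log_terms L1) (log_terms L2).
Proof.
move=> h1 h2; rewrite /log_terms /term_mul /shift_mul map_allpairs allpairs_mapl allpairs_mapr.
apply/eq_in_allpairs => x y xi yi /=.
by rewrite natrM lnM // posrE ltr0n ?(allP h1 _ xi) ?(allP h2 _ yi).
Qed.

Lemma dir_cos_mul D1 D2 s w : dir_cos (shift_mul D1 D2) s w =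
  dir_cos D1 s w * dir_cos D2 s w - dir_sin D1 s w * dir_sin D2 s w.
Proof.
rewrite /dir_cos /dir_sin /shift_mul big_allpairs_dep !mulr_suml -sumrB; apply: eq_bigr => x _.
rewrite !mulr_sumr -sumrB; apply: eq_bigr => y _ /=.
by rewrite !mulrDr cosD opprD expRD; ring.
Qed.

Lemma dir_sin_mul D1 D2 s w : dir_sin (shift_mul D1 D2) s w =
  dir_sin D1 s w * dir_cos D2 s w + dir_cos D1 s w * dir_sin D2 s w.
Proof.
rewrite /dir_cos /dir_sin /shift_mul big_allpairs_dep !mulr_suml -big_split /=; apply: eq_bigr => x _.
rewrite !mulr_sumr -big_split; apply: eq_bigr => y _ /=.
by rewrite !mulrDr sinD opprD expRD; ring.
Qed.

Lemma dir_abs_mul D1 D2 s : dir_abs (shift_mul D1 D2) s = dir_abs D1 s * dir_abs D2 s.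
Proof.
rewrite /dir_abs /shift_mul big_allpairs_dep mulr_suml; apply: eq_bigr => x _.
rewrite mulr_sumr; apply: eq_bigr => y _ /=.
by rewrite normrM mulrDr opprD expRD; ring.
Qed.

(** Multiplicativity of |F|^2. *)
Lemma dir_sq_mul D1 D2 s w :
  dir_cos (shift_mul D1 D2) s w ^+ 2 + dir_sin (shift_mul D1 D2) s w ^+ 2 =
  (dir_cos D1 s w ^+ 2 + dir_sin D1 s w ^+ 2) * (dir_cos D2 s w ^+ 2 + dir_sin D2 s w ^+ 2).
Proof. by rewrite dir_cos_mul dir_sin_mul; ring. Qed.

Variables (h : nat -> R) (q : nat).
Hypothesis hmul : arith_multiplicative h.
Hypothesis hb : forall n, (0 < n)%N -> 0 <= h n <= 1.
Hypothesis q0 : (0 < q)%N.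

(** Value at p^k of the Moebius transform g of f_q. *)
Definition fq_diff (p k : nat) : R := if k is k'.+1 then fq_pp h q p k - fq_pp h q p k' else 1.

Definition local_terms (p : nat) : seq (nat * R) :=
  [seq ((p ^ k)%N, fq_diff p k) | k <- iota 0 (logn p q).+1].

(** The pairs (d, g(d)) for d composed of the given primes, g being
multiplicative and vanishing at p^k when p^k does not divide q. *)
Definition terms_over (ps : seq nat) : seq (nat * R) :=
  foldr (fun p L => term_mul (local_terms p) L) [:: (1%N, 1)] ps.

Lemma pos_local_terms p : (0 < p)%N -> pos_terms (local_terms p).
Proof. by move=> p0; apply/allP => x /mapP[k _ ->] /=; rewrite expn_gt0 p0. Qed.

Lemma pos_terms_over ps : all (fun p => 0 < p)%N ps -> pos_terms (terms_over ps).
Proof.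
elim: ps => //= p ps IH /andP[p0 hps]; apply: pos_term_mul; last exact: IH.
exact: pos_local_terms.
Qed.

Lemma mem_primesW p : p \in primes q -> prime p /\ (p %| q)%N /\ (0 < logn p q)%N.
Proof. by rewrite mem_primes => /and3P[pp _ pq]; rewrite pp pq logn_gt0 mem_primes pp q0 pq. Qed.

Lemma fq_pp_ge p k : p \in primes q -> (logn p q <= k)%N ->
  fq_pp h q p k = fq_pp h q p (logn p q).
Proof. by move=> /mem_primesW[_ [pq _]] ek; rewrite /fq_pp pq /= ltnn ltnNge ek. Qed.

Lemma sum_fq_diff p k : p \in primes q ->
  \sum_(0 <= j < k.+1) fq_diff p j = fq_pp h q p k.
Proof.
move=> /mem_primesW[pp [pq _]]; elim: k => [|k IH].
  by rewrite big_nat1 /= fq_pp0.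
by rewrite big_nat_recr //= IH addrC subrK.
Qed.

(** Telescoping, together with the fact that f_q(p^k) does not change for
k beyond the exponent of p in q. *)
Lemma sum_local_terms_dvd p n : p \in primes q -> (0 < n)%N ->
  \sum_(x <- local_terms p) x.2 * (x.1 %| n)%:R = fq_pp h q p (logn p n).
Proof.
move=> pP n0; have [pp [pq e0]] := mem_primesW pP.
rewrite /local_terms big_map /= -/(index_iota 0 (logn p q).+1).
have -> : \sum_(j <- iota 0 (logn p q).+1) fq_diff p j * (p ^ j %| n)%:R =
   \sum_(0 <= j < (logn p q).+1 | (j < (logn p n).+1)%N) fq_diff p j.
  rewrite [RHS]big_mkcond /index_iota subn0; apply: eq_bigr => j _.
  by rewrite pfactor_dvdn // ltnS; case: (j <= _)%N; rewrite ?mulr1 ?mulr0.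
have [le|lt] := leqP (logn p q) (logn p n).
  rewrite fq_pp_ge // -sum_fq_diff //.
  rewrite [LHS]big_nat_cond [RHS]big_nat_cond; apply: eq_bigl => j.
  by case: (ltnP j (logn p q).+1) => //= jq; rewrite ltnS (leq_trans _ le) // -ltnS.
rewrite -sum_fq_diff // [RHS](big_nat_widen _ _ (logn p q).+1) //; exact: leqW lt.
Qed.

Lemma coprime_terms_over p ps x : prime p -> p \notin ps -> {in ps, forall r, prime r} ->
  x \in terms_over ps -> coprime p x.1.
Proof.
move=> pp; elim: ps x => [|r ps IH] x /=; first by rewrite inE => _ _ /eqP ->; rewrite coprimen1.
rewrite inE negb_or => /andP[pr pps] hps /allpairsP[[y z] /= [yl zl ->]] /=.
rewrite coprimeMr (IH z) // ?andbT; last by move=> w wps; apply: hps; rewrite inE wps orbT.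
move/mapP: yl => [k _ ->] /=; rewrite coprimeXr // prime_coprime //.
by rewrite dvdn_prime2 // hps // mem_head.
Qed.

(** Coprimality of the prime powers splits the condition that a product divides n
into one condition for each prime. *)
Lemma sum_terms_over_dvd (ps : seq nat) n : uniq ps -> {subset ps <= primes q} -> (0 < n)%N ->
  \sum_(x <- terms_over ps) x.2 * (x.1 %| n)%:R = \prod_(p <- ps) fq_pp h q p (logn p n).
Proof.
move=> + + n0; elim: ps => [|p ps IH] /=; first by rewrite !big_cons !big_nil dvd1n mulr1 addr0.
move=> /andP[pps ups] sub.
have pP : p \in primes q by apply: sub; rewrite mem_head.
have subps : {subset ps <= primes q} by move=> r rps; apply: sub; rewrite inE rps orbT.
rewrite big_cons -IH // -sum_local_terms_dvd // big_allpairs_dep mulr_suml.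
apply: eq_big_seq => x xl; rewrite mulr_sumr; apply: eq_big_seq => y yl /=.
rewrite Gauss_dvd; first by rewrite -mulnb natrM; ring.
move/mapP: xl => [k _ ->] /=; apply: coprimeXl; apply: coprime_terms_over yl => //.
  by have [] := mem_primesW pP.
by move=> r /subps /mem_primesW[].
Qed.

(** A form of f_q in which the product runs over a set of primes that does not
depend on n. *)
Lemma fqE_primes n : (0 < n)%N ->
  fq h q n%:Z = \prod_(p <- primes q) fq_pp h q p (logn p n).
Proof.
move=> n0; rewrite fqE // /fq_nat.
rewrite (bigID (fun p => p %| q)%N) /= [X in _ * X]big1_seq ?mulr1; last first.
  by move=> p /andP[/negbTE pq _]; rewrite /fq_pp pq.
rewrite [RHS](bigID (fun p => p %| n)%N) /= [X in _ = _ * X]big1_seq ?mulr1; last first.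
  move=> p /andP[/negbTE pn]; rewrite mem_primes => /and3P[pp _ _].
  by rewrite (_ : logn p n = 0%N) ?fq_pp0 //; apply/eqP; rewrite -leqn0 leqNgt logn_gt0 mem_primes pn !andbF.
rewrite -[LHS]big_filter -[RHS]big_filter; apply: perm_big; apply: uniq_perm; rewrite ?filter_uniq ?primes_uniq //.
by move=> p; rewrite !mem_filter !mem_primes n0 q0 /=; case: (prime p); case: (p %| n)%N; case: (p %| q)%N.
Qed.

Definition moebius_terms := terms_over (primes q).

Lemma sum_moebius_terms_dvd n : (0 < n)%N -> \sum_(x <- moebius_terms) x.2 * (x.1 %| n)%:R = fq h q n%:Z.
Proof. by move=> n0; rewrite fqE_primes // /moebius_terms sum_terms_over_dvd // primes_uniq. Qed.

Lemma pos_moebius_terms : pos_terms moebius_terms.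
Proof.
by apply: pos_terms_over; apply/allP => p; rewrite mem_primes => /and3P[/prime_gt0].
Qed.

Lemma sum_fq N : \sum_(1 <= n < N.+1) fq h q n%:Z = \sum_(x <- moebius_terms) x.2 * (N %/ x.1)%:R.
Proof.
rewrite big_nat_cond (eq_bigr (fun n => \sum_(x <- moebius_terms) x.2 * (x.1 %| n)%:R)).
  rewrite -big_nat_cond exchange_big; apply: eq_bigr => x _.
  by rewrite -mulr_sumr divn_count_dvd natr_sum.
by move=> n /andP[/andP[n0 _] _]; rewrite sum_moebius_terms_dvd.
Qed.

End Divisors.

(** * Mean values of f_q and fractional parts *)

Section Euler.
Context {R : realType}.
Variables (h : nat -> R) (q : nat).
Hypothesis hmul : arith_multiplicative h.
Hypothesis hb : forall n, (0 < n)%N -> 0 <= h n <= 1.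
Hypothesis q0 : (0 < q)%N.

Definition meansum (L : seq (nat * R)) := \sum_(x <- L) x.2 / x.1%:R.

Lemma meansum_mul L1 L2 : meansum (term_mul L1 L2) = meansum L1 * meansum L2.
Proof.
rewrite /meansum /term_mul big_allpairs_dep mulr_suml; apply: eq_bigr => x _.
rewrite mulr_sumr; apply: eq_bigr => y _ /=.
by rewrite natrM invfM; ring.
Qed.

Lemma h_prime_bound p : prime p -> [/\ 0 <= h p <= 1, 2 <= p%:R :> R & h p / p%:R <= 1 / 2].
Proof.
move=> pp; have hp := hb (prime_gt0 pp); have p2 : 2 <= p%:R :> R by rewrite ler_nat prime_gt1.
by split => //; rewrite ler_pdivrMr; lra.
Qed.

(** The partial sums of the local series, for k below the exponent e of p in q,
are explicit; the definition of f_q(p^k) for k >= e is what closes the sum to the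
value with no trace of h(p^e). *)
Lemma meansum_local_terms p : p \in primes q ->
  meansum (local_terms h q p) = ((1 - h p / p%:R) / (1 - p%:R^-1))^-1.
Proof.
move=> pP; have [pp [pq e0]] := mem_primesW q0 pP.
have [hp p2 hp2] := h_prime_bound pp.
rewrite /meansum /local_terms big_map -[LHS]/(\sum_(0 <= j < (logn p q).+1) fq_diff h q p j / (p ^ j)%:R).
set x := p%:R^-1 : R; have xE : p%:R^-1 = x by [].
rewrite xE in hp2; have x0 : 0 < x <= 1 / 2.
  by rewrite invr_gt0 -[x]mul1r ler_pdivrMr; lra.
have hx : 0 < 1 - h p * x by lra.
clearbody x.
have key k : (k < logn p q)%N -> \sum_(0 <= j < k.+1) fq_diff h q p j / (p ^ j)%:R =
    ((1 - x) * (1 - h (p ^ k)%N * x ^+ k) + (h (p ^ k)%N - h (p ^ k.+1)%N * x) * x ^+ k) / (1 - h p * x).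
  elim: k => [|k IH] ke.
    rewrite big_nat1 /= !expn0 expn1 hmul.1 expr0; field; lra.
  rewrite big_nat_recr //= IH ?(ltnW ke) // /fq_pp pq /= ke (ltnW ke) natrX -exprVn xE exprS.
  field; lra.
case E : (logn p q) e0 key => [//|e] _ key.
rewrite big_nat_recr //= key // /fq_pp pq /= E ltnn ltnSn natrX -exprVn xE exprS.
field; lra.
Qed.

Lemma meansum_moebius_terms : meansum (moebius_terms h q) = gammaq h q.
Proof.
rewrite /moebius_terms /gammaq; have : {subset primes q <= primes q} by [].
elim: {1 3 4}(primes q) => [|p ps IH] sub /=.
  by rewrite /meansum big_seq1 big_nil /= divr1.
rewrite big_cons meansum_mul meansum_local_terms ?IH //; last by rewrite sub ?mem_head.
by move=> r rps; apply: sub; rewrite inE rps orbT.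
Qed.

(** Here y = e^t. The sum of f_q up to y is sum_d g(d) floor(y/d), and the mean
value gamma_q is sum_d g(d)/d. *)
Lemma frac_sum_moebius_terms t : frac_sum (log_terms (moebius_terms h q)) t =
  gammaq h q * expR t - \sum_(1 <= n < (Num.truncn (expR t)).+1) fq h q n%:Z.
Proof.
rewrite sum_fq // -meansum_moebius_terms /meansum mulr_suml -sumrB /frac_sum /log_terms big_map.
apply: eq_big_seq => x xl /=; have x0 := allP (pos_moebius_terms h q) _ xl.
rewrite expRB lnK ?posrE ?ltr0n // /frac_part truncn_divn ?expR_ge0 //; ring.
Qed.

End Euler.

(** * Size of the Dirichlet polynomial of the Moebius transform *)

Section LocalBounds.
Context {R : realType}.
Variables (h : nat -> R) (q : nat).
Hypothesis hmul : arith_multiplicative h.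
Hypothesis hb : forall n, (0 < n)%N -> 0 <= h n <= 1.
Hypothesis q0 : (0 < q)%N.

(** Both cases of the definition of f_q at prime powers have one shape, with
b = a when k reaches the exponent of p in q. *)
Lemma fq_pp_form p k : p \in primes q -> exists a b : R,
  [/\ 0 <= a <= 1, 0 <= b <= 1,
     fq_pp h q p k = (a - b / p%:R) / (1 - h p / p%:R) & k = 1%N -> a = h p].
Proof.
move=> pP; have [pp [pq e0]] := mem_primesW q0 pP.
have hpk j : 0 <= h (p ^ j)%N <= 1 by apply: hb; rewrite expn_gt0 prime_gt0.
have [ke|ke] := ltnP k (logn p q).
  exists (h (p ^ k)%N), (h (p ^ k.+1)%N); split => //; last by move=> ->; rewrite expn1.
  by rewrite /fq_pp pq /= ke.
exists (h (p ^ logn p q)%N), (h (p ^ logn p q)%N); split => //.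
  by rewrite /fq_pp pq /= ltnNge ke /=; congr (_ / _); rewrite mulrBr mulr1.
by move=> k1; rewrite (_ : logn p q = 1%N) ?expn1 //; apply/eqP; rewrite eqn_leq e0 -k1 ke.
Qed.

Lemma fq_pp_le2 p k : p \in primes q -> `|fq_pp h q p k| <= 2.
Proof.
move=> pP; have [pp _] := mem_primesW q0 pP.
have [hp p2 hp2] := h_prime_bound hb pp.
have [a [b [ha hb' -> _]]] := fq_pp_form k pP.
have c0 : 0 < 1 - h p / p%:R by lra.
have bp : 0 <= b / p%:R <= 1 by rewrite divr_ge0 ?ler_pdivrMr; lra.
rewrite normrM normfV (gtr0_norm c0) ler_pdivrMr // ler_norml; lra.
Qed.

Lemma fq_diff_le4 p k : p \in primes q -> `|fq_diff h q p k.+1| <= 4.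
Proof.
move=> pP; rewrite /fq_diff (le_trans (ler_normB _ _)) //.
have := fq_pp_le2 k pP; have := fq_pp_le2 k.+1 pP; lra.
Qed.

(** At p the Moebius transform is -(1 - h(p)) up to O(1/p), which after weighting
by p^(-s) is no larger than the contribution of the higher powers of p. *)
Lemma fq_diff1 p : p \in primes q -> `|fq_diff h q p 1 + (1 - h p)| <= 2 / p%:R.
Proof.
move=> pP; have [pp _] := mem_primesW q0 pP.
have [hp p2 hp2] := h_prime_bound hb pp.
have [a [b [ha hb' E /(_ erefl) aE]]] := fq_pp_form 1 pP.
rewrite /fq_diff E aE (fq_pp0 hmul hb q0 pp).
have p0 : 0 < p%:R :> R by lra.
have c0 : 0 < 1 - h p / p%:R by lra.
rewrite (_ : _ + _ = (h p ^+ 2 - b) / p%:R / (1 - h p / p%:R)).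
  rewrite normrM normfV (gtr0_norm c0) normrM normfV (gtr0_norm p0).
  rewrite mulrAC ler_pM2r ?invr_gt0 // ler_pdivrMr //.
  have : `|h p ^+ 2 - b| <= 1; last lra.
  by rewrite ler_norml; nra.
by field; lra.
Qed.

(** p^(-s), written as an exponential to match the transforms. *)
Definition negpow (s : R) (p : nat) : R := expR (- (s * ln p%:R)).

Lemma negpowX s p k : (0 < p)%N -> expR (- (s * ln (p ^ k)%:R)) = negpow s p ^+ k.
Proof.
move=> p0; rewrite natrX lnXn ?ltr0n // /negpow -expRM_natl; congr expR.
by rewrite -[_ *+ k]mulr_natl; ring.
Qed.

Lemma negpow_ge s p : (0 < p)%N -> s <= 1 -> p%:R^-1 <= negpow s p.
Proof.
move=> p0 s1; rewrite /negpow expRN lef_pV2 ?posrE ?expR_gt0 ?ltr0n //.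
rewrite -[leRHS]lnK ?posrE ?ltr0n // ler_expR ler_piMl // ln_ge0 //.
by rewrite ler1n.
Qed.

Lemma negpow_le a b p : (0 < p)%N -> a <= b -> negpow b p <= negpow a p :> R.
Proof.
by move=> p0 ab; rewrite /negpow ler_expR lerN2 ler_wpM2r // ln_ge0 // ler1n.
Qed.

Lemma geometric_tail (r : R) n : 0 <= r <= 1 / 2 ->
  \sum_(2 <= k < n) r ^+ k <= 2 * r ^+ 2.
Proof.
move=> r0; have S m : \sum_(0 <= k < m) r ^+ k <= 2.
  elim: m => [|m IH]; first by rewrite big_geq.
  rewrite big_nat_recl // expr0.
  under eq_bigr do rewrite exprS.
  by rewrite -mulr_sumr; have := ler_wpM2l (proj1 (andP r0)) IH; lra.
have [n2|n2] := leqP n 2; first by rewrite big_geq // mulr_ge0 ?sqr_ge0.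
rewrite -{1}[2%N]add0n big_addn.
under eq_bigr do rewrite exprD mulrC.
by rewrite -mulr_sumr mulrC ler_wpM2r ?sqr_ge0 ?S.
Qed.

Lemma sum_local_terms (F : nat * R -> R) p : p \in primes q ->
  \sum_(x <- local_terms h q p) F x = F (1%N, 1) + F (p, fq_diff h q p 1)
    + \sum_(2 <= k < (logn p q).+1) F ((p ^ k)%N, fq_diff h q p k).
Proof.
move=> pP; have [pp [pq e0]] := mem_primesW q0 pP.
rewrite /local_terms big_map -[LHS]/(\sum_(0 <= j < (logn p q).+1) F ((p ^ j)%N, fq_diff h q p j)).
by rewrite big_ltn // big_ltn ?ltnS // expn0 expn1 addrA.
Qed.

(** The prime powers beyond p contribute like the square of p^(-s); v stands for
a cosine or a sign. *)
Lemma local_terms_tail p s (v : nat -> R) : p \in primes q -> negpow s p <= 1 / 2 ->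
  (forall k, `|v k| <= 1) ->
  `|\sum_(2 <= k < (logn p q).+1) fq_diff h q p k * negpow s p ^+ k * v k| <= 8 * negpow s p ^+ 2.
Proof.
move=> pP r2 hv; have r0 : 0 <= negpow s p by exact: expR_ge0.
apply: (le_trans (ler_norm_sum _ _ _)).
apply: (@le_trans _ _ (\sum_(2 <= k < (logn p q).+1) 4 * negpow s p ^+ k)).
  rewrite [leLHS]big_nat_cond [leRHS]big_nat_cond; apply: ler_sum => -[|k] // _.
  rewrite !normrM (ger0_norm (exprn_ge0 _ r0)).
  rewrite -[leRHS]mulr1 ler_pM ?mulr_ge0 ?exprn_ge0 // ler_wpM2r ?exprn_ge0 //.
  exact: fq_diff_le4.
rewrite -mulr_sumr; have := @geometric_tail _ (logn p q).+1 (introT andP (conj r0 r2)); lra.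
Qed.

(** The constant 10 is 2 for the error in [fq_diff1] plus 8 for the higher
prime powers. *)
Lemma dir_abs_local p s : p \in primes q -> s <= 1 -> negpow s p <= 1 / 2 ->
  dir_abs (log_terms (local_terms h q p)) s <= 1 + (1 - h p) * negpow s p + 10 * negpow s p ^+ 2.
Proof.
move=> pP s1 r2; have [pp [pq e0]] := mem_primesW q0 pP.
have r0 : 0 <= negpow s p by exact: expR_ge0.
have rp := negpow_ge (prime_gt0 pp) s1.
have [hp p2 hp2] := h_prime_bound hb pp.
rewrite /dir_abs /log_terms big_map sum_local_terms //= ln1 mulr0 oppr0 expR0 normr1 mul1r -/(negpow s p).
have h1 : `|fq_diff h q p 1| * negpow s p <= (1 - h p) * negpow s p + 2 * negpow s p ^+ 2.
  have := fq_diff1 pP; rewrite ler_norml => g1.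
  have : `|fq_diff h q p 1| <= (1 - h p) + 2 * negpow s p by rewrite ler_norml; lra.
  by move/(ler_wpM2r r0); rewrite !exprS expr0; lra.
have h2 : \sum_(2 <= k < (logn p q).+1) `|fq_diff h q p k| * expR (- (s * ln (p ^ k)%:R)) <= 8 * negpow s p ^+ 2.
  have hs k : `|Num.sg (fq_diff h q p k)| <= 1 by rewrite normr_sg lern1 leq_b1.
  apply: le_trans (local_terms_tail pP r2 hs); apply: le_trans (ler_norm _); apply: ler_sum => k _.
  by rewrite negpowX ?prime_gt0 // normrEsg [X in _ <= X]mulrAC [fq_diff _ _ _ _ * Num.sg _]mulrC.
lra.
Qed.

(** When cos(w ln p) is near -1 the local factor is about
1 + (1 - h(p)) p^(-s); the real part alone is bounded below. The square p^(-2s)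
enters with 10 as in [dir_abs_local], and the rest of 13 pays for replacing
1 + x by an exponential. *)
Lemma dir_cos_local p s w c : p \in primes q -> s <= 1 -> negpow s p <= 1 / 13 ->
  0 <= c <= 1 -> cos (w * ln p%:R) <= - c ->
  expR (c * ((1 - h p) * negpow s p) - 13 * negpow s p ^+ 2) <= dir_cos (log_terms (local_terms h q p)) s w.
Proof.
move=> pP s1 r13 hc hcos; have [pp [pq e0]] := mem_primesW q0 pP.
have r0 : 0 <= negpow s p by exact: expR_ge0.
have rp := negpow_ge (prime_gt0 pp) s1.
have [hp p2 hp2] := h_prime_bound hb pp.
rewrite /dir_cos /log_terms big_map sum_local_terms //= ln1 !mulr0 oppr0 expR0 cos0 !mulr1 -/(negpow s p) -/(fq_diff h q p 1).
have h1 : c * ((1 - h p) * negpow s p) - 2 * negpow s p ^+ 2 <=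
    fq_diff h q p 1 * negpow s p * cos (w * ln p%:R).
  move: (cos_geN1 (w * ln p%:R)) hcos; move: (cos _) => C C1 hC.
  have := fq_diff1 pP; move: (fq_diff h q p 1) => g; rewrite ler_norml => g1.
  have : - (2 * negpow s p) <= (g + (1 - h p)) * C by nra.
  move=> /(ler_wpM2r r0) h1.
  have : c * (1 - h p) <= - C * (1 - h p) by clear h1; rewrite ler_wpM2r //; lra.
  move=> /(ler_wpM2r r0) h2; rewrite !exprS expr0; lra.
have h2 := @local_terms_tail p s (fun k => cos (w * ln (p ^ k)%:R)) pP ltac:(lra) (fun k => cos_max _).
have {h2} : - (8 * negpow s p ^+ 2) <= \sum_(2 <= k < (logn p q).+1)
   fq_diff h q p k * expR (- (s * ln (p ^ k)%:R)) * cos (w * ln (p ^ k)%:R).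
  move: h2; rewrite ler_norml => /andP[h2 _]; apply: (le_trans h2).
  by apply: ler_sum => k _; rewrite negpowX ?prime_gt0.
move=> h2; set v := c * ((1 - h p) * negpow s p) in h1 *.
have v0 : 0 <= v <= negpow s p.
  have ha : 0 <= 1 - h p <= 1 by lra.
  have hr0 : 0 <= (1 - h p) * negpow s p by rewrite mulr_ge0 //; case/andP: ha.
  rewrite /v mulr_ge0 //=; last by case/andP: hc.
  apply: (@le_trans _ _ ((1 - h p) * negpow s p)); first by rewrite ler_piMl //; case/andP: hc.
  by rewrite ler_piMl //; case/andP: ha.
have r2 : 0 <= negpow s p ^+ 2 <= negpow s p / 13 by rewrite sqr_ge0 expr2; nra.
apply: (@le_trans _ _ (1 + (v - 13 * negpow s p ^+ 2) + (v - 13 * negpow s p ^+ 2) ^+ 2)).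
  apply: expR_le_quadratic; lra.
have : (v - 13 * negpow s p ^+ 2) ^+ 2 <= negpow s p ^+ 2; last lra.
rewrite -[leLHS]real_normK ?num_real // ler_sqr ?nnegrE // ler_norml; lra.
Qed.

(** The quantity K(s) that governs the size of F, and the error term of both
the upper and the lower bounds. *)
Definition weight_sum (s : R) := \sum_(p <- primes q) (1 - h p) * negpow s p.
Definition square_sum (s : R) := \sum_(p <- primes q) negpow s p ^+ 2.

Lemma square_sum_le a b : a <= b -> square_sum b <= square_sum a :> R.
Proof.
move=> ab; rewrite /square_sum big_seq [leRHS]big_seq; apply: ler_sum => p.
rewrite mem_primes => /and3P[/prime_gt0 p0 _ _].
by rewrite ler_sqr ?nnegrE ?expR_ge0 // negpow_le.
Qed.

Lemma log_terms_over_cons p ps : all (fun r => 0 < r)%N (p :: ps) ->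
  log_terms (terms_over h q (p :: ps)) = shift_mul (log_terms (local_terms h q p)) (log_terms (terms_over h q ps)).
Proof.
move=> /andP[p0 hps]; rewrite /= log_terms_mul //; first exact: pos_local_terms.
exact: pos_terms_over.
Qed.

Lemma dir_abs_moebius_terms s : s <= 1 -> {in primes q, forall p, negpow s p <= 1 / 2} ->
  dir_abs (log_terms (moebius_terms h q)) s <= expR (weight_sum s + 10 * square_sum s).
Proof.
move=> s1 hr; rewrite /moebius_terms /weight_sum /square_sum; have : {subset primes q <= primes q} by [].
elim: {1 3 4 5}(primes q) => [|p ps IH] sub.
  by rewrite /dir_abs /= !big_cons !big_nil /= ln1 !(mulr0, oppr0, addr0, mul1r) expR0 normr1 mul1r.
have pos : all (fun r => 0 < r)%N (p :: ps).
  by apply/allP => r /sub; rewrite mem_primes => /and3P[/prime_gt0].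
rewrite log_terms_over_cons // dir_abs_mul !big_cons mulrDr addrACA expRD.
have pP : p \in primes q by rewrite sub ?mem_head.
apply: ler_pM; first by apply: sumr_ge0 => x _; rewrite mulr_ge0 ?expR_ge0.
- by apply: sumr_ge0 => x _; rewrite mulr_ge0 ?expR_ge0.
- by apply: (le_trans (dir_abs_local pP s1 (hr _ pP))); rewrite -addrA expR_ge1Dx.
- by apply: IH => r rps; apply: sub; rewrite inE rps orbT.
Qed.

Lemma dir_sq_moebius_terms s w c : s <= 1 -> {in primes q, forall p, negpow s p <= 1 / 13} ->
  0 <= c <= 1 -> {in primes q, forall p, cos (w * ln p%:R) <= - c} ->
  expR (c * weight_sum s - 13 * square_sum s) ^+ 2 <=
  dir_cos (log_terms (moebius_terms h q)) s w ^+ 2 + dir_sin (log_terms (moebius_terms h q)) s w ^+ 2.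
Proof.
move=> s1 hr hc hcos; rewrite /moebius_terms /weight_sum /square_sum; have : {subset primes q <= primes q} by [].
elim: {1 3 4 5 6}(primes q) => [|p ps IH] sub.
  rewrite /dir_cos /dir_sin /= !big_cons !big_nil /= ln1 !(mulr0, oppr0, addr0, mul1r, subr0) expR0 cos0 sin0.
  by rewrite mulr1 lerDl sqr_ge0.
have pos : all (fun r => 0 < r)%N (p :: ps).
  by apply/allP => r /sub; rewrite mem_primes => /and3P[/prime_gt0].
rewrite !big_cons !mulrDr opprD addrACA expRD exprMn log_terms_over_cons // dir_sq_mul.
have pP : p \in primes q by rewrite sub ?mem_head.
apply: ler_pM; rewrite ?sqr_ge0 //; last first.
  by apply: IH => r rps; apply: sub; rewrite inE rps orbT.
apply: (@le_trans _ _ (dir_cos (log_terms (local_terms h q p)) s w ^+ 2)); last by rewrite lerDl sqr_ge0.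
have hle := dir_cos_local pP s1 (hr _ pP) hc (hcos _ pP).
rewrite ler_sqr ?nnegrE ?expR_ge0 //; last exact: le_trans (expR_ge0 _) hle.
Qed.

End LocalBounds.

(** * The Maier matrix *)

Section Maier.
Context {R : realType}.
Variables (a h : nat -> R) (q : nat).
Hypothesis a0 : forall n, (0 < n)%N -> 0 <= a n.
Hypothesis hmul : arith_multiplicative h.
Hypothesis hb : forall n, (0 < n)%N -> 0 <= h n <= 1.
Hypothesis q0 : (0 < q)%N.

Lemma modz_natE (m n : nat) : (m%:Z == n%:Z %[mod q%:Z])%Z = (m == n %[mod q])%N.
Proof. by rewrite !modz_nat eqz_nat. Qed.

(** A full period contains exactly one integer of the progression. *)
Lemma summatory_mod_step (N s : nat) : (N == s %[mod q])%N ->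
  \sum_(1 <= n < (N + q).+1 | (n%:Z == s%:Z %[mod q%:Z])%Z) a n =
  \sum_(1 <= n < N.+1 | (n%:Z == s%:Z %[mod q%:Z])%Z) a n + a (N + q)%N.
Proof.
move=> /eqP Ns; rewrite (@big_cat_nat _ _ _ N.+1) //=; last by rewrite ltnS leq_addr.
congr (_ + _); rewrite -(prednK q0) addnS big_mkcond big_nat_recr /=; last by rewrite ltnS leq_addr.
rewrite prednK // big1_seq ?add0r; last first.
  move=> n /andP[_]; rewrite mem_index_iota => /andP[n1 n2].
  rewrite modz_natE; case: ifP => // /eqP; rewrite -Ns => /eqP.
  rewrite eqn_mod_dvd ?(ltnW n1) // => /dvdn_leq; rewrite subn_gt0 n1 => /(_ isT).
  lia.
by rewrite modz_natE -addnS prednK // modnDr Ns eqxx.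
Qed.

Lemma summatory_mod_progression (M K s : nat) :
  summatory_mod a ((M + K) * q + s)%:R q s%:Z - summatory_mod a (M * q + s)%:R q s%:Z =
  \sum_(M.+1 <= r < (M + K).+1) a (r * q + s)%N.
Proof.
rewrite /summatory_mod !natrK; elim: K => [|K IH]; first by rewrite addn0 subrr big_geq.
rewrite (_ : ((M + K.+1) * q + s)%N = ((M + K) * q + s + q)%N); last by rewrite addnS mulSn; lia.
rewrite summatory_mod_step; last by rewrite modnMDl.
rewrite addnS [RHS]big_nat_recr /=; last by rewrite ltnS leq_addr.
rewrite -IH addrAC; congr (_ + a _); rewrite mulSn; lia.
Qed.

Lemma summatory_short (v : nat) (y : R) : 0 <= y ->
  summatory a (v%:R + y) - summatory a v%:R =
  \sum_(1 <= s < (Num.truncn y).+1) a (v + s)%N.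
Proof.
move=> y0; rewrite /summatory truncnD ?natr_nat ?nnegrE // natrK.
rewrite (@big_cat_nat _ _ _ v.+1) //=; last by rewrite ltnS leq_addr.
rewrite addrAC subrr add0r -[in X in index_iota X _](add1n v) big_addn.
by rewrite -addnS addKn; apply: eq_bigr => s _; rewrite addnC.
Qed.

Lemma summatory_mod_le (y x : R) (b : int) : y <= x ->
  0 <= summatory_mod a y q b <= summatory a x.
Proof.
move=> yx; rewrite /summatory_mod /summatory big_mkcond big_nat_cond [X in _ <= _ <= X]big_nat_cond.
apply/andP; split.
  by apply: sumr_ge0 => n /andP[/andP[n1 _] _]; case: ifP => // _; rewrite a0.
rewrite -!big_nat_cond [leRHS](@big_cat_nat _ _ _ (Num.truncn y).+1) //=; last first.
  by rewrite ltnS le_truncn.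
apply: ler_wpDr.
  rewrite big_nat_cond; apply: sumr_ge0 => n /andP[/andP[n1 _] _]; rewrite a0 //.
  exact: leq_trans n1.
rewrite [leLHS]big_nat_cond [leRHS]big_nat_cond; apply: ler_sum => n /andP[/andP[n1 _] _].
by case: ifP => // _; rewrite a0.
Qed.

Lemma summatory_le (y x : R) : y <= x -> 0 <= summatory a y <= summatory a x.
Proof.
move=> yx; rewrite /summatory; apply/andP; split.
  by rewrite big_nat_cond; apply: sumr_ge0 => n /andP[/andP[n1 _] _]; rewrite a0.
rewrite [leRHS](@big_cat_nat _ _ _ (Num.truncn y).+1) //=; last by rewrite ltnS le_truncn.
rewrite lerDl big_nat_cond; apply: sumr_ge0 => n /andP[/andP[n1 _] _]; rewrite a0 //.
exact: leq_trans n1.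
Qed.

Lemma gammaq_bounds : 0 < gammaq h q <= 1.
Proof.
rewrite /gammaq big_seq; apply: (big_ind (fun v : R => 0 < v <= 1)).
- by rewrite ltr01 lexx.
- by move=> u v /andP[u0 u1] /andP[v0 v1]; rewrite mulr_gt0 //= mulr_ile1 // ltW.
move=> p; rewrite mem_primes => /and3P[pp _ _].
have [hp p2 hp2] := h_prime_bound hb pp.
have pi2 : 0 < (p%:R^-1 : R) <= 1 / 2.
  by rewrite invr_gt0 -[p%:R^-1]mul1r ler_pdivrMr; lra.
have hp1 : h p / p%:R <= p%:R^-1 by rewrite ler_piMl; lra.
rewrite invf_div divr_gt0 /= ?ler_pdivrMr; lra.
Qed.

Variable x : R.
Hypothesis x0 : 0 < x.
Hypothesis A0 : 0 < summatory a x.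

(** The bound on the set behind Delta comes from f_q(b) depending only on
gcd(b, q), which takes finitely many values. *)
Lemma Delta_bound B (y : R) (b : int) : Delta a h x q <= B -> x / 4 <= y <= x ->
  `|summatory_mod a y q b - fq h q b / (q%:R * gammaq h q) * (y / x) * summatory a x|
  <= B * summatory a x / (totient q)%:R.
Proof.
move=> hB hy; have f0 : 0 < (totient q)%:R :> R by rewrite ltr0n totient_gt0.
move: hB; rewrite /Delta ler_pdivrMr ?divr_gt0 // [leRHS]mulrA => hB.
apply: le_trans hB.
apply: ub_le_sup; last by exists y, b.
have /andP[g0 _] := gammaq_bounds; have qr : 0 < q%:R :> R by rewrite ltr0n.
exists (summatory a x + (\sum_(d < q.+1) `|fq_nat h q d|) / (q%:R * gammaq h q) * summatory a x).
move=> _ [y' [b' [/andP[hy1 hy2] ->]]]; apply: (le_trans (ler_normB _ _)); apply: lerD.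
  by have /andP[h1 h2] := summatory_mod_le b' hy2; rewrite ger0_norm.
rewrite normrM (gtr0_norm A0) ler_wpM2r ?(ltW A0) //.
have y1 : 0 <= y' / x <= 1 by rewrite divr_ge0 ?ler_pdivrMr ?mul1r //; lra.
rewrite normrM (ger0_norm (proj1 (andP y1))) -[leRHS]mulr1.
apply: ler_pM => //; first by case/andP: y1.
  rewrite normrM normfV (gtr0_norm (mulr_gt0 qr g0)) ler_pM2r ?invr_gt0 ?mulr_gt0 //.
  have fq_diff : (gcdn `|b'| q < q.+1)%N by rewrite ltnS dvdn_leq // dvdn_gcdr.
  rewrite /fq (bigD1 (Ordinal fq_diff)) //= lerDl; exact: sumr_ge0.
by case/andP: y1.
Qed.

(** Any interval admitted in the supremum ends before x, so that the set is
bounded by means of the total sum up to x. *)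
Lemma tDelta_bound B (y v : R) : tDelta a x y <= B -> 0 < y -> x / 4 <= v -> v + y <= x ->
  `|summatory a (v + y) - summatory a v - y * (summatory a x / x)| <= B * y * (summatory a x / x).
Proof.
move=> hB y0 v1 v2; move: hB; rewrite /tDelta ler_pdivrMr ?mulr_gt0 ?invr_gt0 // [leRHS]mulrA => hB.
apply: le_trans hB; apply: ub_le_sup; last first.
  by exists v; split => // t /=; rewrite !in_itv/=; lra.
exists (summatory a x + y * (summatory a x / x)) => _ [w [hw ->]].
have wx : w + y <= x.
  rewrite leNgt; apply/negP => xw.
  have : (`]w, w + y[%classic) (Num.max (w + y / 2) x).
    by rewrite /= in_itv /= lt_max gt_max; apply/andP; split; [apply/orP; left|apply/andP; split]; lra.
  by move/hw; rewrite /= in_itv /= gt_max ltxx !andbF.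
apply: (le_trans (ler_normB _ _)); rewrite lerD //; last first.
  by rewrite ger0_norm // mulr_ge0 ?divr_ge0 // ltW.
have /andP[h1 h2] := summatory_le wx.
have /andP[h3 h4] := @summatory_le w (w + y) ltac:(lra).
rewrite ger0_norm; lra.
Qed.

(** Rows are indexed by r in (R, 2R] with R q just above x/4, which keeps every
row and column inside [x/4, x]. A column is a difference of two sums over a
progression, hence the two errors Delta_q; and x/R <= 4q turns 2 into 8. *)
Lemma maier_matrix B (y : R) : 0 < y -> 0 <= B -> 2 * q%:R + y <= x / 2 ->
  Delta a h x q <= B -> tDelta a x y <= B ->
  `|gammaq h q * y - \sum_(1 <= s < (Num.truncn y).+1) fq h q s%:Z| <=
  gammaq h q * (1 + 8 * (q%:R / (totient q)%:R)) * B * y.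
Proof.
move=> y0 B0 hqy hD hT.
have /andP[g0 _] := gammaq_bounds; have qr : 0 < q%:R :> R by rewrite ltr0n.
have f0 : 0 < (totient q)%:R :> R by rewrite ltr0n totient_gt0.
(* r is the R of the description: the least integer with r q > x/4. *)
set r := (Num.truncn (x / (4 * q%:R))).+1.
have rq1 : x / 4 < r%:R * q%:R.
  by have := truncnS_gt (x / (4 * q%:R)); rewrite -/r ltr_pdivrMr ?mulr_gt0 //; lra.
have rq2 : r%:R * q%:R <= x / 4 + q%:R.
  have : ((Num.truncn (x / (4 * q%:R)))%:R <= x / (4 * q%:R)).
    by rewrite truncn_le divr_ge0 ?mulr_ge0 // ltW.
  have -> : r%:R = (Num.truncn (x / (4 * q%:R)))%:R + 1 :> R by rewrite natr1.
  by rewrite ler_pdivlMr ?mulr_gt0 //; lra.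
have r0 : 0 < r%:R :> R by rewrite ltr0n.
have A1 := A0; set A := summatory a x; rewrite -/A in A1; set F := \sum_(_ <= s < _) _.
set M := \sum_(r.+1 <= i < (r + r).+1) \sum_(1 <= s < (Num.truncn y).+1) a (i * q + s)%N.
have rows : `|M - r%:R * (y * (A / x))| <= r%:R * (B * y * (A / x)).
  have -> : r%:R * (y * (A / x)) = \sum_(r.+1 <= i < (r + r).+1) (y * (A / x)).
    by rewrite sumr_const_nat subSS addnK mulr_natl.
  have -> : r%:R * (B * y * (A / x)) = \sum_(r.+1 <= i < (r + r).+1) (B * y * (A / x)).
    by rewrite sumr_const_nat subSS addnK mulr_natl.
  rewrite /M -sumrB; apply: (le_trans (ler_norm_sum _ _ _)).
  rewrite [leLHS]big_nat_cond [leRHS]big_nat_cond; apply: ler_sum => i /andP[/andP[i1 i2] _].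
  rewrite -summatory_short ?(ltW y0) //.
  have j1 : r%:R * q%:R <= (i * q)%:R :> R by rewrite natrM ler_pM2r // ler_nat ltnW.
  have j2 : (i * q)%:R <= 2 * (r%:R * q%:R) :> R.
    by rewrite natrM mulrA ler_pM2r // -natrM ler_nat mul2n -addnn -ltnS.
  by apply: tDelta_bound => //; lra.
have cols : `|M - r%:R * (A / (gammaq h q * x)) * F| <= 2 * y * (B * A / (totient q)%:R).
  rewrite /M exchange_big /= /F mulr_sumr -sumrB.
  have tr : (Num.truncn y)%:R <= y by rewrite truncn_le ltW.
  apply: (@le_trans _ _ (\sum_(1 <= s < (Num.truncn y).+1) (2 * (B * A / (totient q)%:R)))).
    apply: (le_trans (ler_norm_sum _ _ _)).
    rewrite [leLHS]big_nat_cond [leRHS]big_nat_cond; apply: ler_sum => s /andP[/andP[s1 s2] _].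
    rewrite -summatory_mod_progression.
    have sy : 0 <= (s%:R : R) <= y by apply/andP; split => //; apply: le_trans tr; rewrite ler_nat -ltnS.
    have n1 : (r * q + s)%:R = r%:R * q%:R + s%:R :> R by rewrite natrD natrM.
    have n2 : ((r + r) * q + s)%:R = 2 * (r%:R * q%:R) + s%:R :> R.
      by rewrite natrD natrM natrD; ring.
    have b1 : x / 4 <= (r * q + s)%:R <= x by lra.
    have b2 : x / 4 <= ((r + r) * q + s)%:R <= x by lra.
    have {b1} := Delta_bound s%:Z hD b1; have {b2} := Delta_bound s%:Z hD b2.
    rewrite n1 n2 -/A; move: (fq _ _ _) => f.
    set c := B * A / _; move: (summatory_mod _ _ _ _) (summatory_mod _ _ _ _) => S1 S2.
    rewrite !ler_norml => /andP[u1 u2] /andP[w1 w2].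
    have -> : S2 - S1 - r%:R * (A / (gammaq h q * x)) * f =
      (S2 - f / (q%:R * gammaq h q) * ((2 * (r%:R * q%:R) + s%:R) / x) * A) -
      (S1 - f / (q%:R * gammaq h q) * ((r%:R * q%:R + s%:R) / x) * A).
      by field; rewrite !gt_eqF.
    by apply/andP; split; lra.
  rewrite sumr_const_nat subn1 /= -[leLHS]mulr_natl [2 * y]mulrC -[leRHS]mulrA.
  by rewrite ler_wpM2r // !mulr_ge0 ?invr_ge0 // ltW.
have fin : `|r%:R * (y * (A / x)) - r%:R * (A / (gammaq h q * x)) * F| <=
   r%:R * (B * y * (A / x)) + 2 * y * (B * A / (totient q)%:R).
  move: rows cols; rewrite !ler_norml => /andP[u1 u2] /andP[w1 w2].
  by apply/andP; split; lra.
have k0 : 0 < gammaq h q * x / (r%:R * A) by rewrite divr_gt0 ?mulr_gt0.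
have -> : gammaq h q * y - F = gammaq h q * x / (r%:R * A) *
    (r%:R * (y * (A / x)) - r%:R * (A / (gammaq h q * x)) * F).
  by field; rewrite !gt_eqF.
rewrite normrM (gtr0_norm k0); apply: (le_trans (ler_wpM2l (ltW k0) fin)).
have -> : gammaq h q * x / (r%:R * A) * (r%:R * (B * y * (A / x)) + 2 * y * (B * A / (totient q)%:R))
  = gammaq h q * B * y + 2 * y * B * gammaq h q * (x / r%:R) / (totient q)%:R.
  by field; rewrite !gt_eqF.
have -> : gammaq h q * (1 + 8 * (q%:R / (totient q)%:R)) * B * y
  = gammaq h q * B * y + 2 * y * B * gammaq h q * (4 * q%:R) / (totient q)%:R.
  by field; rewrite !gt_eqF.
rewrite lerD2l ler_pM2r ?invr_gt0 // ler_wpM2l //; first by rewrite !mulr_ge0 // ltW.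
rewrite ler_pdivrMr //; lra.
Qed.

End Maier.

(** * Reciprocals of large primes *)

Section PrimeSums.
Context {R : realType}.

(** Two distinct primes above the square root of N cannot both divide m <= N. *)
Lemma count_large_divisors (ps : seq nat) m N : uniq ps -> all prime ps ->
  (forall p, p \in ps -> (N < p * p)%N) -> (0 < m <= N)%N ->
  (\sum_(p <- ps) (p %| m) <= 1)%N.
Proof.
move=> u pr big /andP[m0 mN]; have -> : (\sum_(p <- ps) (p %| m) = count (fun p => p %| m) ps)%N.
  by rewrite -sum1_count [RHS]big_mkcond; apply: eq_bigr => p _; case: (p %| m)%N.
rewrite -size_filter.
case E : [seq p <- ps | (p %| m)%N] => [|p [|r s]] //.
have uf : uniq [:: p, r & s] by rewrite -E filter_uniq.
have : p \in [seq p <- ps | (p %| m)%N] by rewrite E mem_head.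
have : r \in [seq p <- ps | (p %| m)%N] by rewrite E !inE eqxx orbT.
rewrite !mem_filter => /andP[rm rps] /andP[pm pps].
have pnr : p != r by move: uf => /= /andP[]; rewrite inE negb_or => /andP[].
have cop : coprime p r.
  by rewrite prime_coprime ?(allP pr) // dvdn_prime2 ?(allP pr).
have : (p * r <= N)%N by apply: leq_trans mN; rewrite dvdn_leq // Gauss_dvd // pm.
have := big _ rps; have := big _ pps; nia.
Qed.

(** Count pairs (p, m) with p dividing m <= N: there are at least N/(2p) of them
for each p, and at most one for each m. *)
Lemma sum_inv_large_primes (ps : seq nat) N : uniq ps -> all prime ps -> (0 < N)%N ->
  (forall p, p \in ps -> (p <= N)%N /\ (N < p * p)%N) ->
  \sum_(p <- ps) p%:R^-1 <= 2 :> R.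
Proof.
move=> u pr N0 hp.
have S : (\sum_(p <- ps) N %/ p <= N)%N.
  under eq_bigr => p _ do rewrite divn_count_dvd.
  rewrite exchange_big /=; apply: (@leq_trans (\sum_(1 <= m < N.+1) 1)); last by rewrite sum_nat_const_nat muln1 subn1.
  rewrite [X in (X <= _)%N]big_nat_cond [X in (_ <= X)%N]big_nat_cond; apply: leq_sum => m /andP[/andP[m1 m2] _].
  by apply: (@count_large_divisors _ _ N) => // [p /hp[]//|]; rewrite m1.
have NR : 0 < N%:R :> R by rewrite ltr0n.
rewrite -(ler_pM2l NR) mulr_sumr; apply: (@le_trans _ _ ((\sum_(p <- ps) N %/ p)%:R * 2)).
  rewrite natr_sum mulr_suml big_seq [leRHS]big_seq; apply: ler_sum => p pps.
  have [pN _] := hp _ pps; have p0 : (0 < p)%N by rewrite prime_gt0 ?(allP pr).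
  rewrite ler_pdivrMr ?ltr0n // -!natrM ler_nat.
  have := ltn_ceil N p0; have : (0 < N %/ p)%N by rewrite divn_gt0.
  nia.
by rewrite ler_pM2r // ler_nat.
Qed.

Lemma ratio_totient_le q : (0 < q)%N ->
  q%:R <= (totient q)%:R * expR (2 * \sum_(p <- primes q) p%:R^-1) :> R.
Proof.
move=> q0; rewrite totientE // {1}(prod_prime_decomp q0) prime_decompE big_map /=.
have : {in primes q, forall p, prime p && (0 < logn p q)%N}.
  by move=> p; rewrite logn_gt0 => pP; rewrite pP andbT; move: pP; rewrite mem_primes => /and3P[].
elim: (primes q) => [|p ps IH] hps; first by rewrite !big_nil mulr0 expR0 mulr1.
rewrite !big_cons mulrDr expRD !natrM mulrACA.
apply: ler_pM => //; last by apply: IH => r rps; apply: hps; rewrite inE rps orbT.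
have /andP[pp e0] := hps p (mem_head _ _).
rewrite -{1}(prednK e0) expnS natrM [X in _ <= X * _]mulrC -mulrA mulrC ler_wpM2l //.
have p2 : 2 <= p%:R :> R by rewrite ler_nat prime_gt1.
have p1 : p.-1%:R = p%:R - 1 :> R by rewrite -subn1 natrB ?prime_gt0.
rewrite p1; have h := expR_ge1Dx (2 * p%:R^-1 : R).
apply: (@le_trans _ _ ((p%:R - 1) * (1 + 2 * p%:R^-1))); last by rewrite ler_wpM2l //; lra.
rewrite (_ : _ * _ = p%:R + 1 - 2 * p%:R^-1); last by field; lra.
have : p%:R^-1 <= 2^-1 :> R by rewrite lef_pV2 ?posrE //; lra.
lra.
Qed.

End PrimeSums.

(** * Dependence of the weighted prime sum on the exponent *)

Section Ksums.
Context {R : realType}.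
Variables (h : nat -> R) (q : nat).
Hypothesis hb : forall n, (0 < n)%N -> 0 <= h n <= 1.

Lemma weight_ge0 p : p \in primes q -> 0 <= 1 - h p.
Proof. by rewrite mem_primes => /and3P[/prime_gt0/hb /andP[_ h1] _ _]; rewrite subr_ge0. Qed.

Lemma negpow_shift (s d : R) p : negpow (s - d) p = expR (d * ln p%:R) * negpow s p.
Proof. by rewrite /negpow -expRD; congr expR; ring. Qed.

Lemma negpow1 p : (0 < p)%N -> negpow 1 p = p%:R^-1 :> R.
Proof. by move=> p0; rewrite /negpow mul1r expRN lnK // posrE ltr0n. Qed.

Lemma weight_sum_shift_le s d e : {in primes q, forall p, d * ln p%:R <= e} ->
  weight_sum h q (s - d) <= expR e * weight_sum h q s.
Proof.
move=> hd; rewrite /weight_sum mulr_sumr big_seq [leRHS]big_seq; apply: ler_sum => p pP.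
rewrite negpow_shift mulrCA ler_wpM2r ?ler_expR ?hd // mulr_ge0 ?expR_ge0 //.
exact: weight_ge0.
Qed.

Lemma weight_sum_shift_ge s d e : {in primes q, forall p, e <= d * ln p%:R} ->
  expR e * weight_sum h q s <= weight_sum h q (s - d).
Proof.
move=> hd; rewrite /weight_sum mulr_sumr big_seq [leRHS]big_seq; apply: ler_sum => p pP.
rewrite negpow_shift [leRHS]mulrCA ler_wpM2r ?ler_expR ?hd // mulr_ge0 ?expR_ge0 //.
exact: weight_ge0.
Qed.

Lemma weight_sum1 : weight_sum h q 1 = \sum_(p <- primes q) (1 - h p) / p%:R.
Proof.
rewrite /weight_sum big_seq [RHS]big_seq; apply: eq_bigr => p.
by rewrite mem_primes => /and3P[/prime_gt0 p0 _ _]; rewrite negpow1.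
Qed.

(** The exponent s is chosen through the value of the sum, by continuity. *)
Lemma weight_sum_ivt s0 v : s0 <= 1 -> weight_sum h q 1 <= v <= weight_sum h q s0 ->
  exists2 s, s0 <= s <= 1 & weight_sum h q s = v.
Proof.
move=> s01 hv; have [||s] := @IVT R (weight_sum h q) s0 1 v s01.
- apply: continuous_subspaceT; rewrite /weight_sum; elim: (primes q) => [|p ps IH].
    rewrite (_ : (fun s => _) = cst 0); first exact: cst_continuous.
    by apply/funext => s; rewrite big_nil.
  rewrite (_ : (fun s => _) = (fun s => (1 - h p) * negpow s p + \sum_(p <- ps) (1 - h p) * negpow s p)).
    move=> s; apply: cvgD; last exact: IH.
    apply: cvgM; first exact: cvg_cst.
    apply: continuous_comp; last exact: continuous_expR.
    by apply: cvgN; apply: cvgM; [exact: cvg_id|exact: cvg_cst].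
  by apply/funext => s; rewrite big_cons.
- by rewrite ge_min le_max; lra.
by rewrite in_itv /= => hs E; exists s.
Qed.

End Ksums.

(** * Oscillation of the mean value of f_q *)

Section Oscillation.
Context {R : realType}.
Variables (h : nat -> R) (q : nat).
Hypothesis hmul : arith_multiplicative h.
Hypothesis hb : forall n, (0 < n)%N -> 0 <= h n <= 1.
Hypothesis q0 : (0 < q)%N.
(** L stands for ln z; the conditions on L, eta and u are those that the ranges in
the theorem provide once x is large. *)
Variables L eta u : R.
Hypothesis hL : 10 * 100 <= L.
Hypothesis heta : 0 < eta <= 1 / 100.
Hypothesis hetaL : ln eta^-1 <= L / 20.
Hypothesis hu : 5 / eta ^+ 2 <= u.
Hypothesis huL : ln u <= L / 2.
Hypothesis hp : {in primes q, forall p, (1 - eta) * L <= ln p%:R <= L}.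
Hypothesis hW : \sum_(p <- primes q) p%:R^-1 <= 2 :> R.
Hypothesis hK : eta ^+ 2 <= \sum_(p <- primes q) (1 - h p) / p%:R.

(** In units of L, the middle of the window from u to u (1 + 22 eta) of ln y, where the mass
of the Mellin integral is to be placed. *)
Let kappa := u * (1 + 11 * eta).

Lemma u_eta : 5 <= eta ^+ 2 * u.
Proof.
have e2 : 0 < eta ^+ 2 by rewrite exprn_gt0; case/andP: heta.
by move: hu; rewrite ler_pdivrMr // mulrC.
Qed.

Lemma u_large : 200 * 200 <= u.
Proof.
have ue := u_eta; have /andP[e0 e1] := heta.
have e2 : eta ^+ 2 <= (1 / 100) * (1 / 100) by rewrite expr2; nra.
have e3 : 0 < eta ^+ 2 by rewrite exprn_gt0.
rewrite leNgt; apply/negP => lt.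
have : eta ^+ 2 * u < eta ^+ 2 * (200 * 200) by rewrite ltr_pM2l.
lra.
Qed.

Lemma weight_sum1_le2 : weight_sum h q 1 <= 2.
Proof.
rewrite weight_sum1; apply: le_trans hW; rewrite big_seq [leRHS]big_seq; apply: ler_sum => p.
rewrite mem_primes => /and3P[/prime_gt0/hb hp1 _ _].
by rewrite ler_piMl ?invr_ge0 //; lra.
Qed.

(** The sum K is at most 2 at s = 1 and reaches kappa before
xi = (1 - s) L exceeds ln(kappa/eta^2)/(1 - eta), since p^(1-s) >= e^(xi (1 - eta)).
The lower bound on xi holds because K(s) <= 2 e^xi while kappa is large. *)
Lemma saddle_point : exists s : R, [/\ weight_sum h q s = kappa, s <= 1, 9 <= (1 - s) * L
  & (1 - s) * L * (1 - eta) <= ln (kappa / eta ^+ 2)].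
Proof.
have /andP[e0 e1] := heta; have u1 := u_large.
have e2 : 0 < eta ^+ 2 by rewrite exprn_gt0.
have k1 : 200 * 200 <= kappa by rewrite /kappa; nra.
have L0 : 0 < L by have := hL; lra.
have ke : 0 < kappa / eta ^+ 2 by rewrite divr_gt0 //; lra.
set x := ln (kappa / eta ^+ 2) / (1 - eta).
have ke1 : 1 <= kappa / eta ^+ 2.
  by rewrite ler_pdivlMr // mul1r; rewrite expr2; nra.
have x0 : 0 <= x by rewrite divr_ge0 ?ln_ge0 //; lra.
have xE : x * (1 - eta) = ln (kappa / eta ^+ 2) by rewrite divfK //; lra.
have [||s /andP[s0 s1] s_saddle] := @weight_sum_ivt _ h q (1 - x / L) kappa.
- by rewrite lerBlDr lerDl divr_ge0 // ltW.
- apply/andP; split; first by have := weight_sum1_le2; lra.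
  apply: (@le_trans _ _ (expR (x * (1 - eta)) * weight_sum h q 1)).
    rewrite xE lnK ?posrE // weight_sum1 -[leLHS](divfK (_ : eta ^+ 2 != 0)) ?gt_eqF //.
    by rewrite ler_wpM2l // ltW.
  apply: weight_sum_shift_ge => // p /hp /andP[hp1 _].
  by rewrite [leRHS]mulrAC ler_pdivlMr // -mulrA ler_wpM2l.
exists s; split => //; last first.
  by rewrite -xE ler_wpM2r //; [lra | rewrite -ler_pdivlMr //; lra].
rewrite leNgt; apply/negP => lt9.
have : kappa <= expR 9 * weight_sum h q 1.
  rewrite -s_saddle (_ : s = 1 - (1 - s)); last by ring.
  apply: weight_sum_shift_le => // p /hp /andP[_ hp2].
  by apply: (le_trans (ler_wpM2l _ hp2)); lra.
have := @expR_nat_le3 R 9; have := weight_sum1_le2; have := expR_gt0 (9 : R).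
have : 3 ^+ 9 * 2 < 200 * 200 :> R by rewrite !exprS expr0; lra.
nra.
Qed.

Section AtSaddle.
Variable s : R.
Hypothesis s_saddle : weight_sum h q s = kappa.
Hypothesis xi_ge9 : 9 <= (1 - s) * L.
Hypothesis xi_upper : (1 - s) * L * (1 - eta) <= ln (kappa / eta ^+ 2).

Lemma kappa_gt0 : 0 < kappa.
Proof. by have u1 := u_large; have /andP[e0 e1] := heta; rewrite mulr_gt0 //; lra. Qed.

Lemma ln_kappa : ln (kappa / eta ^+ 2) = ln u + ln (1 + 11 * eta) + 2 * ln eta^-1.
Proof.
have u1 := u_large; have /andP[e0 e1] := heta.
have e3 : 0 < eta^-1 by rewrite invr_gt0.
rewrite /kappa !lnM ?posrE ?mulr_gt0 ?invr_gt0 ?exprn_gt0 //; try lra.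
by rewrite -exprVn lnXn // -[_ *+ 2]mulr_natl.
Qed.

(** Both u <= z^(1/2) and 1/eta <= z^(1/20) enter here, so that
kappa/eta^2 is about z^(3/5) at most. *)
Lemma xi_le : (1 - s) * L <= 61 / 100 * L.
Proof.
have /andP[e0 e1] := heta; have l1 := hL; have l2 := huL; have l3 := hetaL.
have l4 : ln (1 + 11 * eta) <= 11 * eta by apply: le_ln1Dx; lra.
have x9 := xi_ge9; have := xi_upper; rewrite ln_kappa.
have : (1 - s) * L * (99 / 100) <= (1 - s) * L * (1 - eta) by rewrite ler_wpM2l; lra.
lra.
Qed.

Lemma s_ge : 39 / 100 <= s.
Proof.
have l1 := hL; have := xi_le; rewrite ler_pM2r; lra.
Qed.

(** The angle pi ln p / L lies within pi eta of pi. *)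
Lemma cos_at_primes p : p \in primes q ->
  cos (pi / L * ln p%:R) <= - (1 - 8 * eta ^+ 2).
Proof.
move=> /hp /andP[p1 p2]; have l1 := hL; have /andP[e0 e1] := heta.
have L0 : 0 < L by lra.
have pi4 : pi <= 4 :> R by have := pihalf_lt2 R; lra.
have pi0 := pi_gt0 R.
rewrite (_ : pi / L * ln p%:R = - (pi * (1 - ln p%:R / L)) + pi); last by field; lra.
have t1 : 0 <= 1 - ln p%:R / L <= eta.
  apply/andP; split; first by rewrite subr_ge0 ler_pdivrMr // mul1r.
  by rewrite lerBlDr addrC -lerBlDr ler_pdivlMr //; lra.
rewrite cosDpi cosN lerN2; have := cos_ge_quadratic (pi * (1 - ln p%:R / L)).
move: (1 - _) t1 => t /andP[t0 t1].
have : (pi * t) ^+ 2 <= (4 * eta) ^+ 2.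
  rewrite ler_sqr ?nnegrE ?mulr_ge0 //; try lra.
  by apply: ler_pM; lra.
rewrite [(4 * eta) ^+ 2]exprMn (_ : 4 ^+ 2 = 16); last by rewrite expr2; ring.
lra.
Qed.

(** The exponent of Rankin's bound to the right of the window. *)
Let s1 := s - 3 * eta / L.

Lemma s1_ge : 38 / 100 <= s1.
Proof.
have l1 := hL; have /andP[e0 e1] := heta; have := s_ge; rewrite /s1.
have : 3 * eta / L <= 1 / 100 by rewrite ler_pdivrMr; lra.
lra.
Qed.

Lemma negpow_small p : p \in primes q -> negpow s1 p <= 1 / 13.
Proof.
move=> /hp /andP[p1 p2]; have l1 := hL; have /andP[e0 e1] := heta; have h1 := s1_ge.
rewrite /negpow expRN mul1r lef_pV2 ?posrE ?expR_gt0 //.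
apply: (le_trans _ (expR_ge1Dx _)).
have p3 : 99 / 100 * L <= ln p%:R by apply: le_trans p1; rewrite ler_pM2r; lra.
have : 38 / 100 * (99 / 100 * L) <= s1 * ln p%:R by apply: ler_pM; lra.
lra.
Qed.

(** Here p^(-2s) is p^(-1) times at most z^(-(1 - eta)) e^(2 xi), and e^xi is at most
about kappa/eta^2 <= z^(61/100). The comparison with eta^2 kappa, and not with a
constant, is needed when u is close to z^(1/2). *)
Lemma square_sum_small : 23 * square_sum q s1 <= eta ^+ 2 * kappa.
Proof.
have l1 := hL; have /andP[e0 e1] := heta; have h1 := s1_ge; have l3 := hetaL.
have k0 := kappa_gt0; have x9 := xi_ge9; have x1 := xi_le.
have L0 : 0 < L by lra.
set E := 2 * ((1 - s) * L) + 6 * eta - (1 - eta) * L.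
have h2 : square_sum q s1 <= 2 * expR E.
  apply: (@le_trans _ _ ((\sum_(p <- primes q) p%:R^-1) * expR E)); last first.
    by rewrite ler_wpM2r ?expR_ge0.
  rewrite /square_sum mulr_suml big_seq [leRHS]big_seq; apply: ler_sum => p pP.
  have /andP[p1 p2] := hp pP; have p0 : (0 < p)%N by move: pP; rewrite mem_primes => /and3P[/prime_gt0].
  rewrite -negpow1 // /negpow -expRM_natl -expRD ler_expR.
  have : (1 - s1) * ln p%:R <= (1 - s1) * L.
    rewrite ler_wpM2l // /s1; have : 0 <= 3 * eta / L by rewrite divr_ge0; lra.
    have : 0 < 1 - s by rewrite -(pmulr_lgt0 _ L0); lra.
    lra.
  rewrite {2}/s1 (_ : (1 - (s - 3 * eta / L)) * L = (1 - s) * L + 3 * eta); last by field; lra.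
  rewrite /E; lra.
(* eta^2 kappa = eta^4 (kappa/eta^2), with eta^4 >= e^(-L/5). *)
have h3 : expR (- (L / 5) + (1 - s) * L * (1 - eta)) <= eta ^+ 2 * kappa.
  have -> : eta ^+ 2 * kappa = eta ^+ 4 * (kappa / eta ^+ 2) by field; lra.
  rewrite expRD; apply: ler_pM; rewrite ?expR_ge0 //.
    have -> : eta ^+ 4 = expR (- (4 * ln eta^-1)).
      by rewrite -mulrN lnV ?posrE // opprK expRM_natl lnK ?posrE.
    by rewrite ler_expR; lra.
  by rewrite -[leRHS]lnK ?posrE ?divr_gt0 ?exprn_gt0 // ler_expR.
apply: le_trans h3; apply: (@le_trans _ _ (46 * expR E)); first lra.
have h4 : 46 <= expR (100 : R) by apply: (le_trans _ (expR_ge1Dx _)); lra.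
apply: (@le_trans _ _ (expR 100 * expR E)); first by rewrite ler_wpM2r ?expR_ge0.
rewrite -expRD ler_expR /E.
have : (1 - s) * L * eta <= (1 - s) * L * (1 / 100) by rewrite ler_wpM2l; lra.
have : L * eta <= L * (1 / 100) by rewrite ler_wpM2l; lra.
lra.
Qed.

(** The exponent of Rankin's bound to the left of the window, and the logarithm
of the lower bound for |F(s + i pi/L)|. *)
Let s2 := s + 3 * eta / L.
Let g := (1 - 8 * eta ^+ 2) * kappa - 13 * square_sum q s1.

(** With kappa = u(1 + 11 eta) and step delta = 3 eta, the exponent on the left is
kappa + kappa delta^2 - delta (u (1 + 22 eta) - kappa) up to small terms, that is
kappa - (33 - 9) eta^2 u; the loss kappa - g is about 9 eta^2 u. *)
Lemma gap_upper :
  kappa * expR (3 * eta) - 3 * eta * (u * (1 + 22 * eta)) + 10 * square_sum q s1 + 10 <= g.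
Proof.
have /andP[e0 e1] := heta; have ue := u_eta; have hR := square_sum_small; have u1 := u_large.
have h1 : expR (3 * eta) <= 1 + 3 * eta + (3 * eta) ^+ 2 by apply: expR_le_quadratic; lra.
have k0 := kappa_gt0.
have h2 : kappa * expR (3 * eta) <= kappa * (1 + 3 * eta + 9 * eta ^+ 2).
  by rewrite ler_wpM2l ?(ltW k0) // (le_trans h1) // exprMn !expr2; lra.
have h3 : eta * (eta ^+ 2 * u) <= 1 / 100 * (eta ^+ 2 * u) by rewrite ler_wpM2r //; lra.
move: hR h2 ue h3; rewrite /g /kappa !expr2; move: (expR _) (square_sum _ _) => x y; clear h1 k0; lra.
Qed.

(** The mirror image of [gap_upper]. Lowering xi by delta is only known to
shrink K by e^(-(1 - eta) delta), because the primes start at z^(1 - eta). *)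
Lemma gap_lower :
  kappa * expR (- ((1 - eta) * (3 * eta))) + 3 * eta * u + 10 * square_sum q s1 + 10 <= g.
Proof.
have /andP[e0 e1] := heta; have ue := u_eta; have hR := square_sum_small; have u1 := u_large.
have h1 : expR (- ((1 - eta) * (3 * eta))) <=
    1 + - ((1 - eta) * (3 * eta)) + (- ((1 - eta) * (3 * eta))) ^+ 2.
  by apply: expR_le_quadratic; nra.
have k0 := kappa_gt0.
have h2 : kappa * expR (- ((1 - eta) * (3 * eta))) <= kappa * (1 - 3 * eta + 12 * eta ^+ 2).
  rewrite ler_wpM2l ?(ltW k0) // (le_trans h1) //.
  have : (- ((1 - eta) * (3 * eta))) ^+ 2 <= 9 * eta ^+ 2.
    rewrite sqrrN (_ : 9 * eta ^+ 2 = (3 * eta) ^+ 2); last by ring.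
    by rewrite ler_sqr ?nnegrE ?ler_piMl ?mulr_ge0 //; lra.
  rewrite !expr2; lra.
have h3 : eta * (eta ^+ 2 * u) <= 1 / 100 * (eta ^+ 2 * u) by rewrite ler_wpM2r //; lra.
move: hR h2 ue h3; rewrite /g /kappa !expr2; move: (expR _) (square_sum _ _) => x y; clear h1 k0; lra.
Qed.

Lemma g_large : 20 <= g.
Proof.
have /andP[e0 e1] := heta; have ue := u_eta; have hR := square_sum_small; have u1 := u_large.
have k0 := kappa_gt0.
have k1 : u <= kappa by rewrite /kappa ler_peMr //; lra.
have h3 : eta ^+ 2 * kappa <= 1 / 100 * kappa by rewrite ler_wpM2r ?(ltW k0) // expr2; nra.
by move: hR h3; rewrite /g; move: (square_sum _ _) => y; lra.
Qed.

(** The transform of the fractional part at s + i pi/L is of the size of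
1/(1 - s): the pole at 1 is at distance comparable with 1 - s since
xi >= 9 > 2 pi, and s stays away from 0. *)
Lemma kernel_mass : 1 / (10 * (1 - s)) <= (\int[lebesgue_measure]_t kernel_cos s (pi / L) t)%R.
Proof.
have l1 := hL; have x9 := xi_ge9; have x1 := xi_le; have s39 := s_ge.
have L0 : 0 < L by lra.
have pi4 : pi <= 4 :> R by have := pihalf_lt2 R; lra.
have pi0 := pi_gt0 R.
have b0 : 0 < 1 - s by rewrite -(pmulr_lgt0 _ L0); lra.
have w0 : 0 < pi / L by rewrite divr_gt0.
have wb : 9 * (pi / L) <= 4 * (1 - s).
  rewrite mulrA ler_pdivrMr // -mulrA; lra.
apply: le_trans (kernel_cos_lower _ w0 _); [|lra|lra].
have -> : s * pi / (4 * (pi / L)) = s * L / 4 by field; lra.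
set E := expR _.
have hE : E <= 1 / 90.
  rewrite /E expRN mul1r lef_pV2 ?posrE ?expR_gt0 //.
  apply: (le_trans _ (expR_ge1Dx _)).
  have : 39 / 100 * (10 * 100) <= s * L by apply: ler_pM; lra.
  lra.
have i1 : (1 - s - pi / L)^-1 <= 9 / 5 * (1 - s)^-1.
  rewrite -[9 / 5]invf_div -invfM lef_pV2 ?posrE; lra.
have i2 : 2 * E / s <= 6 / 100.
  by rewrite ler_pdivrMr; lra.
have i3 : 1 <= (1 - s)^-1.
  by rewrite invf_ge1 //; lra.
rewrite invfM mul1r; lra.
Qed.

(** The exponents s1 and s2 are so close to s that the factors of Rankin's bound
remain comparable with 1/(1 - s). *)
Lemma mellin_mass r : 38 / 100 <= r -> (1 - s) / 2 <= 1 - r ->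
  (1 - r)^-1 + r^-1 <= 4 / (1 - s).
Proof.
move=> r38 hr; have l1 := hL; have x9 := xi_ge9; have x1 := xi_le.
have L0 : 0 < L by lra.
have b0 : 0 < 1 - s by rewrite -(pmulr_lgt0 _ L0); lra.
have b1 : 1 - s <= 61 / 100 by rewrite -(ler_pM2r L0).
have i1 : (1 - r)^-1 <= 2 * (1 - s)^-1.
  by rewrite -[2]invrK -invfM lef_pV2 ?posrE; lra.
have i2 : r^-1 <= (38 / 100)^-1 by rewrite lef_pV2 ?posrE; lra.
have i3 : (61 / 100)^-1 <= (1 - s)^-1 by rewrite lef_pV2 ?posrE; lra.
have j2 : (38 / 100)^-1 = 100 / 38 :> R by field.
have j3 : (61 / 100)^-1 = 100 / 61 :> R by field.
rewrite j2 in i2; rewrite j3 in i3; lra.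
Qed.

Variable e : R.
Hypothesis e_ge0 : 0 <= e.
Hypothesis e_le : e <= 650 * expR (- (u * (1 + 25 * eta) * ln (2 * u / eta ^+ 2))).
Hypothesis hT : forall t, u * L <= t <= u * (1 + 22 * eta) * L ->
  `|frac_sum (log_terms (moebius_terms h q)) t| <= e * expR t.

(** The point where the shape of the bound in the theorem is used:
xi (1 - eta) <= ln(2u/eta^2) and (1 + 22 eta) <= (1 + 25 eta)(1 - eta). *)
Lemma window_term : e * expR ((1 - s) * (u * (1 + 22 * eta) * L)) <= expR g / 100.
Proof.
have /andP[e0 e1] := heta; have u1 := u_large; have l1 := hL; have x9 := xi_ge9.
have ke : 0 < kappa / eta ^+ 2 by rewrite divr_gt0 ?kappa_gt0 ?exprn_gt0.
have h1 : ln (kappa / eta ^+ 2) <= ln (2 * u / eta ^+ 2).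
  rewrite ler_ln ?posrE // ?divr_gt0 ?exprn_gt0 //; last lra.
  by rewrite ler_pM2r ?invr_gt0 ?exprn_gt0 // /kappa mulrC ler_pM2r; lra.
have h2 := le_trans xi_upper h1.
have eB := e_le; move: h2 eB; move: (ln (2 * u / _)) => Lam h2 eB.
have h3 : (1 - s) * L * (1 + 22 * eta) <= (1 + 25 * eta) * Lam.
  apply: (@le_trans _ _ ((1 + 25 * eta) * ((1 - s) * L * (1 - eta)))).
    have : 0 <= (1 - s) * L * (eta * (2 - 25 * eta)).
      have h5 : 0 <= eta * (2 - 25 * eta) by rewrite mulr_ge0; lra.
      by rewrite mulr_ge0 //; lra.
    lra.
  by rewrite ler_wpM2l //; lra.
have h4 : expR (- (u * (1 + 25 * eta) * Lam)) * expR ((1 - s) * (u * (1 + 22 * eta) * L)) <= 1.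
  rewrite -expRD expR_le1 addrC subr_le0.
  rewrite (_ : (1 - s) * _ = u * ((1 - s) * L * (1 + 22 * eta))); last by ring.
  by rewrite -[leRHS]mulrA ler_wpM2l //; lra.
have : e * expR ((1 - s) * (u * (1 + 22 * eta) * L)) <= 650.
  have := ler_wpM2r (expR_ge0 ((1 - s) * (u * (1 + 22 * eta) * L))) eB.
  move: h4; move: (expR _) (expR _) => E1 E2 h4 h6.
  by apply: (le_trans h6); rewrite -mulrA; lra.
have gl := g_large; rewrite -ler_expR in gl => h7.
have h8 := @expR_nat_ge2 R 20.
have : 650 * 100 <= 2 ^+ 20 :> R by rewrite !exprS expr0; lra.
move: gl h7 h8; move: (expR g) (expR 20) (e * expR _) => E1 E2 E3 gl h7 h8 h9; lra.
Qed.

Lemma small_factor (k : R) : k + 10 <= g -> expR k <= expR g / 400.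
Proof.
move=> hk; have := @expR_nat_ge2 R 10; have : 400 <= 2 ^+ 10 :> R by rewrite !exprS expr0; lra.
have h1 : expR k * expR 10 <= expR g by rewrite -expRD ler_expR.
have := expR_gt0 k; nra.
Qed.

Lemma upper_term : expR ((s1 - s) * (u * (1 + 22 * eta) * L)) *
  (dir_abs (log_terms (moebius_terms h q)) s1 * ((1 - s1)^-1 + s1^-1)) <= expR g / 100 / (1 - s).
Proof.
have /andP[e0 e1] := heta; have u1 := u_large; have l1 := hL; have x9 := xi_ge9.
have h38 := s1_ge; have L0 : 0 < L by lra.
have d0 : 0 <= 3 * eta / L by rewrite divr_ge0; lra.
have b0 : 0 < 1 - s by rewrite -(pmulr_lgt0 _ L0); lra.
have s1le : s1 <= 1 by rewrite /s1; lra.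
have hm := @mellin_mass s1 h38 ltac:(rewrite /s1; lra).
have hd : dir_abs (log_terms (moebius_terms h q)) s1 <= expR (kappa * expR (3 * eta) + 10 * square_sum q s1).
  apply: (le_trans (dir_abs_moebius_terms hmul hb q0 s1le _)).
    by move=> p pP; apply: (le_trans (negpow_small pP)); lra.
  rewrite ler_expR lerD2r mulrC -s_saddle; apply: weight_sum_shift_le => // p /hp /andP[_ p2].
  by rewrite mulrAC ler_pdivrMr // ler_wpM2l //; lra.
have d1 : 0 <= dir_abs (log_terms (moebius_terms h q)) s1.
  by apply: sumr_ge0 => x _; rewrite mulr_ge0 ?expR_ge0.
rewrite (_ : (s1 - s) * _ = - (3 * eta * (u * (1 + 22 * eta)))); last by rewrite /s1; field; lra.
apply: (le_trans (ler_wpM2l (expR_ge0 _) (ler_pM d1 _ hd hm))).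
  by rewrite addr_ge0 ?invr_ge0 //; lra.
rewrite [leLHS]mulrA -expRD [leLHS]mulrA ler_pM2r ?invr_gt0 //.
have := @small_factor (- (3 * eta * (u * (1 + 22 * eta))) + (kappa * expR (3 * eta) + 10 * square_sum q s1)) _.
by move=> /(_ ltac:(have := gap_upper; lra)); lra.
Qed.

Lemma lower_term : expR ((s2 - s) * (u * L)) *
  (dir_abs (log_terms (moebius_terms h q)) s2 * ((1 - s2)^-1 + s2^-1)) <= expR g / 100 / (1 - s).
Proof.
have /andP[e0 e1] := heta; have u1 := u_large; have l1 := hL; have x9 := xi_ge9.
have h38 := s1_ge; have L0 : 0 < L by lra.
have d0 : 0 <= 3 * eta / L by rewrite divr_ge0; lra.
have b0 : 0 < 1 - s by rewrite -(pmulr_lgt0 _ L0); lra.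
have hd2 : 3 * eta / L <= (1 - s) / 2 by rewrite ler_pdivrMr //; lra.
have s2le : s2 <= 1 by rewrite /s2; lra.
have s12 : s1 <= s2 by rewrite /s1 /s2; lra.
have hm := @mellin_mass s2 ltac:(lra) ltac:(rewrite /s2; lra).
have hd : dir_abs (log_terms (moebius_terms h q)) s2 <=
    expR (kappa * expR (- ((1 - eta) * (3 * eta))) + 10 * square_sum q s1).
  apply: (le_trans (dir_abs_moebius_terms hmul hb q0 s2le _)).
    move=> p pP; apply: (@le_trans _ _ (negpow s1 p)).
      by apply: negpow_le => //; move: pP; rewrite mem_primes => /and3P[/prime_gt0].
    by apply: (le_trans (negpow_small pP)); lra.
  rewrite ler_expR lerD //; last by rewrite ler_wpM2l // square_sum_le.
  rewrite mulrC -s_saddle /s2 -[3 * eta / L]opprK; apply: weight_sum_shift_le => // p /hp /andP[p1 _].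
  rewrite mulNr lerN2 [leRHS]mulrAC ler_pdivlMr // mulrC [leRHS]mulrC mulrA ler_wpM2r //; lra.
have d1 : 0 <= dir_abs (log_terms (moebius_terms h q)) s2.
  by apply: sumr_ge0 => x _; rewrite mulr_ge0 ?expR_ge0.
rewrite (_ : (s2 - s) * _ = 3 * eta * u); last by rewrite /s2; field; lra.
apply: (le_trans (ler_wpM2l (expR_ge0 _) (ler_pM d1 _ hd hm))).
  by rewrite addr_ge0 ?invr_ge0 //; lra.
rewrite [leLHS]mulrA -expRD [leLHS]mulrA ler_pM2r ?invr_gt0 //.
have := @small_factor (3 * eta * u + (kappa * expR (- ((1 - eta) * (3 * eta))) + 10 * square_sum q s1)) _.
by move=> /(_ ltac:(have := gap_lower; lra)); lra.
Qed.

Lemma saddle_contradiction : False.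
Proof.
have /andP[e0 e1] := heta; have u1 := u_large; have l1 := hL; have x9 := xi_ge9.
have h38 := s1_ge; have L0 : 0 < L by lra.
have d0 : 0 < 3 * eta / L by rewrite divr_gt0 // mulr_gt0.
have b0 : 0 < 1 - s by rewrite -(pmulr_lgt0 _ L0); lra.
have hd2 : 3 * eta / L <= (1 - s) / 2 by rewrite ler_pdivrMr //; lra.
have eta2 : 0 <= 1 - 8 * eta ^+ 2 <= 1.
  have t0 : 0 <= eta ^+ 2 by exact: sqr_ge0.
  have t1 : eta ^+ 2 <= 1 / 100 * (1 / 100) by rewrite expr2; apply: ler_pM; lra.
  by lra.
have s1s : s1 <= s by rewrite /s1; lra.
have D0 r : 0 <= dir_abs (log_terms (moebius_terms h q)) r.
  by apply: sumr_ge0 => x _; rewrite mulr_ge0 ?expR_ge0.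
have M0 r : 38 / 100 <= r -> (1 - s) / 2 <= 1 - r -> 0 <= (1 - r)^-1 + r^-1.
  by move=> r1 r2; rewrite addr_ge0 ?invr_ge0 //; lra.
have M1 := M0 s1 h38 ltac:(rewrite /s1; lra).
have M2 := M0 s2 ltac:(move: h38; rewrite /s1 /s2; lra) ltac:(rewrite /s2; lra).
have s1_gt0 : 0 < s1 by lra.
have s1_lt : s1 < s by rewrite /s1; lra.
have s2_gt : s < s2 by rewrite /s2; lra.
have s2_lt : s2 < 1 by rewrite /s2; lra.
have Z0 : 0 <= 1 / (10 * (1 - s)) by rewrite divr_ge0 // mulr_ge0 // ltW.
have hg : expR g <= expR ((1 - 8 * eta ^+ 2) * weight_sum h q s - 13 * square_sum q s).
  by rewrite ler_expR s_saddle /g lerD2l lerN2 ler_wpM2l // square_sum_le.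
have low := @dir_sq_moebius_terms _ h q hmul hb q0 s (pi / L) (1 - 8 * eta ^+ 2) ltac:(lra).
have {}low := low (fun p pP => le_trans (negpow_le (prime_gt0 (mem_primesW q0 pP).1) s1s)
  (negpow_small pP)) eta2 cos_at_primes.
apply: (@mass_comparison R (expR g) (1 - s) _ _ (expR_gt0 _) b0 _ _
  (@transform_le_window R (log_terms (moebius_terms h q)) s s1 s2 (pi / L) (u * L)
    (u * (1 + 22 * eta) * L) e _ s1_gt0 s1_lt s2_gt s2_lt e_ge0 hT Z0 kernel_mass)).
  by apply: le_trans low; rewrite ler_sqr ?nnegrE ?expR_ge0.
apply/andP; split.
  apply: addr_ge0; first apply: addr_ge0.
  - by rewrite !mulr_ge0 ?expR_ge0 ?invr_ge0 ?(ltW b0).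
  - exact: mulr_ge0 (expR_ge0 _) (mulr_ge0 (D0 _) M1).
  - exact: mulr_ge0 (expR_ge0 _) (mulr_ge0 (D0 _) M2).
have wt := ler_wpM2r (_ : 0 <= (1 - s)^-1) window_term.
have {}wt := wt (ltac:(by rewrite invr_ge0 ltW)).
apply: (le_trans (lerD (lerD wt upper_term) lower_term)).
by move: (expR g) ((1 - s)^-1) => x y; lra.
Qed.

End AtSaddle.

(** The mean value of f_q over [1, y] cannot approximate gamma_q too well at every
y in the window [z^u, z^(u (1 + 22 eta))], here in the variable t = ln y. *)
Lemma oscillation (e : R) : 0 <= e ->
  e <= 650 * expR (- (u * (1 + 25 * eta) * ln (2 * u / eta ^+ 2))) ->
  ~ (forall t, u * L <= t <= u * (1 + 22 * eta) * L ->
       `|frac_sum (log_terms (moebius_terms h q)) t| <= e * expR t).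
Proof.
move=> e0 eB hT; have [s [s_saddle _ xi_ge9 xi_upper]] := saddle_point.
refine (saddle_contradiction s_saddle xi_ge9 xi_upper e0 eB hT).
Qed.

End Oscillation.

(** * Ranges of the parameters and the main result *)

Section Final.
Context {R : realType}.

(** The lower bounds on eta and z make ln z at least 20 ln ln ln x, and 1/eta at
most ln ln x <= z^(1/20). *)
Lemma large_parameters (x eta z : R) : expR (expR (expR 50)) <= x ->
  20 * ln (ln (ln x)) / ln (ln x) <= eta <= 1 / 100 ->
  ln x `^ eta <= z ->
  [/\ [/\ x = expR (ln x), ln x = expR (ln (ln x)) & ln (ln x) = expR (ln (ln (ln x)))],
      50 <= ln (ln (ln x)), 0 < eta, 0 < z & 20 * ln (ln (ln x)) <= ln z] /\ ln eta^-1 <= ln z / 20.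
Proof.
move=> hx /andP[e1 e2] hz.
have h1 := ln_expR_le hx; have h2 := ln_expR_le h1; have h3 := ln_expR_le h2.
have x0 : 0 < x := lt_le_trans (expR_gt0 _) hx.
have l1 : 0 < ln x := lt_le_trans (expR_gt0 _) h1.
have l2 : 0 < ln (ln x) := lt_le_trans (expR_gt0 _) h2.
have z0 : 0 < z by apply: lt_le_trans hz; rewrite powR_gt0.
have e0 : 0 < eta by apply: lt_le_trans e1; rewrite divr_gt0 // mulr_gt0 //; lra.
have hLz : eta * ln (ln x) <= ln z by rewrite -ln_powR ler_ln ?posrE ?powR_gt0.
rewrite ler_pdivrMr // in e1.
have hLz2 : 20 * ln (ln (ln x)) <= ln z by lra.
split; first by split => //; rewrite !lnK ?posrE.
apply: (@le_trans _ _ (ln (ln (ln x)))); last lra.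
rewrite ler_ln ?posrE ?invr_gt0 // -[leLHS]mul1r ler_pdivrMr //; lra.
Qed.

(** Both q and y are at most e^(2z) <= x^(2/3), the latter because
u ln z <= z^(1/2) z^(1/2). *)
Lemma modulus_window_fit (x z u eta t Q : R) : 0 < x -> 0 < z -> z <= ln x / 3 ->
  10 * 100 <= ln z -> u <= Num.sqrt z -> eta <= 1 / 100 -> 0 <= u -> 0 <= eta ->
  Q <= expR (2 * z) -> t <= u * (1 + 22 * eta) * ln z -> 2 * Q + expR t <= x / 2.
Proof.
move=> x0 z0 zx hL hu e1 u0 e0 hQ ht.
have sz : Num.sqrt z = expR (ln z / 2) by rewrite mulrC -powR_expR // powR12_sqrt // ltW.
have szz : Num.sqrt z * Num.sqrt z = z by rewrite -expr2 sqr_sqrtr // ltW.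
have Ls : ln z <= Num.sqrt z.
  have := @expR_ge1Dxn R (ln z / 2) 1 ltac:(lra); rewrite -sz; apply: le_trans.
  rewrite (_ : 2`!%:R = 2) // expr2; move: hL; move: (ln z) => l l0.
  by have := ler_wpM2r (_ : 0 <= l) l0; move=> /(_ ltac:(lra)); lra.
have tz : t <= 2 * z.
  apply: (le_trans ht); rewrite -[X in _ <= 2 * X]szz mulrA.
  apply: ler_pM => //; [by rewrite mulr_ge0 //; lra|lra|].
  by rewrite [leLHS]mulrC; apply: ler_pM => //; lra.
have z1 : 10 * 100 <= z.
  by apply: (le_trans hL); rewrite -[leRHS]lnK ?posrE //; apply: le_trans (expR_ge1Dx _); lra.
have h1 : expR (2 * z) * expR z <= x.
  by rewrite -expRD -[leRHS]lnK ?posrE // ler_expR; lra.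
have h2 : 6 <= expR z by apply: le_trans (expR_ge1Dx _); lra.
have h3 : expR t <= expR (2 * z) by rewrite ler_expR.
have h4 := ler_wpM2l (expR_ge0 (2 * z)) h2.
lra.
Qed.

End Final.

Theorem theorem2p5 (R : realType) :
  exists x0 c : R, 0 < c /\
  forall x : R, x0 <= x ->
  forall (a : nat -> R) (S : set nat) (h : nat -> R),
  (forall n : nat, (0 < n)%N -> 0 <= a n) ->
  0 < summatory a x ->
  finite_set S ->
  (forall p : nat, S p -> prime p) ->
  (forall p : nat, S p -> 1 <= (p%:R : R) <= ln (ln x)) ->
  arith_multiplicative h ->
  (forall n : nat, (0 < n)%N -> 0 <= h n <= 1) ->
  forall eta z : R,
  20 * ln (ln (ln x)) / ln (ln x) <= eta <= 1 / 100 ->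
  ln x `^ eta <= z <= ln x / 3 ->
  \sum_(1 <= p < (Num.truncn z).+1 | prime p && (z `^ (1 - eta) <= p%:R))
      (1 - h p) / p%:R >= eta * ln ((1 - eta)^-1) ->
  forall u : R, 5 / eta ^+ 2 <= u <= Num.sqrt z ->
  (forall q : nat, (0 < q)%N ->
     q%:R <= expR (2 * z) ->
     (forall p : nat, prime p -> (p %| q)%N -> z `^ (1 - eta) <= p%:R <= z) ->
     \sum_(p <- primes q) (1 - h p) / p%:R >= eta ^+ 2 ->
     coprime_to_primes S q /\
     Delta a h x q >=
       c * expR (- (u * (1 + 25 * eta) * ln (2 * u / eta ^+ 2))))
  \/
  (exists y : R, y >= z `^ u /\
     tDelta a x y >=
       c * expR (- (u * (1 + 25 * eta) * ln (2 * u / eta ^+ 2)))).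
Proof.
(* The factor exp(20) to spare in the oscillation bound allows c = 1. *)
exists (expR (expR (expR 50))), 1; split => // x hx a S h ha hA _ hSp hS hmul hb eta z heta
  /andP[hz1 hz2] _ u /andP[hu1 hu2].
set B := 1 * expR _.
have [[[x_e lx_e llx_e] l3 e0 z0 hL] heL] := large_parameters hx heta hz1.
have /andP[_ e1] := heta.
have hL3 : 10 * 100 <= ln z by lra.
have B0 : 0 <= B by rewrite /B mul1r expR_ge0.
have [II|notII] := pselect (exists y : R, y >= z `^ u /\ tDelta a x y >= B); first by right.
left=> q q0 hq hp hK.
have hpL : {in primes q, forall p, (1 - eta) * ln z <= ln p%:R <= ln z}.
  move=> p; rewrite mem_primes => /and3P[pp _ pq]; have /andP[p1 p2] := hp p pp pq.
  have p0 : 0 < p%:R :> R by rewrite ltr0n prime_gt0.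
  by rewrite -ln_powR !ler_ln ?posrE ?powR_gt0 // p1 p2.
split.
  move=> p /[dup] /hSp pp /hS /andP[_ pS]; apply/negP => pq.
  have /hpL /andP[p1 _] : p \in primes q by rewrite mem_primes pp q0 pq.
  have : ln p%:R <= ln (ln (ln x)) by rewrite ler_ln ?posrE ?ltr0n ?prime_gt0 // llx_e expR_gt0.
  have : eta * ln z <= 1 / 100 * ln z by rewrite ler_wpM2r //; lra.
  lra.
rewrite leNgt; apply/negP => hD.
have x0 : 0 < x by rewrite x_e expR_gt0.
have u0 : 0 < u by apply: lt_le_trans hu1; rewrite divr_gt0 // exprn_gt0.
have huL : ln u <= ln z / 2.
  rewrite mulrC -ln_powR powR12_sqrt ?(ltW z0) // ler_ln ?posrE // sqrtr_gt0 //.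
have hW : \sum_(p <- primes q) p%:R^-1 <= 2 :> R.
  apply: (@sum_inv_large_primes R _ (Num.truncn z)); first exact: primes_uniq.
  - by apply/allP => p; rewrite mem_primes => /and3P[].
  - rewrite truncn_gt0 -[z]lnK ?posrE // -[1]expR0 ler_expR; lra.
  move=> p pP; have /andP[p1 p2] := hpL p pP.
  have p0 : 0 < p%:R :> R by move: pP; rewrite mem_primes ltr0n => /and3P[/prime_gt0].
  split; first by rewrite truncn_ge_nat ?(ltW z0) // -ler_ln ?posrE.
  rewrite truncn_lt_nat ?(ltW z0) // natrM -ltr_ln ?posrE ?mulr_gt0 // lnM ?posrE //.
  have : eta * ln z <= 1 / 100 * ln z by rewrite ler_wpM2r //; lra.
  lra.
have f0 : 0 < (totient q)%:R :> R by rewrite ltr0n totient_gt0.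
have hphi : q%:R / (totient q)%:R <= 81 :> R.
  rewrite ler_pdivrMr // mulrC; apply: (le_trans (ratio_totient_le q0)).
  rewrite ler_wpM2l ?(ltW f0) //; apply: (@le_trans _ _ (expR 4)); first by rewrite ler_expR; lra.
  by have h34 := @expR_nat_le3 R 4; apply: (le_trans h34); rewrite !exprS expr0; lra.
have /andP[g0 g1] := gammaq_bounds q hb.
have heta' : 0 < eta <= 1 / 100 by rewrite e0.
(* e y is the bound of the Maier matrix; e <= (1 + 8 * 81) B <= 650 B. *)
pose e := gammaq h q * (1 + 8 * (q%:R / (totient q)%:R)) * B.
have r0 : 0 <= q%:R / (totient q)%:R :> R by rewrite divr_ge0 // ltW.
apply: (@oscillation R h q hmul hb q0 (ln z) eta u hL3 heta' heL hu1 huL hpL hW hK e).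
- by rewrite /e !mulr_ge0 ?(ltW g0) // addr_ge0 // mulr_ge0.
- rewrite /e -[expR _]mul1r -/B ler_wpM2r // -[650]mul1r; clear - g0 g1 r0 hphi.
  by apply: ler_pM; lra.
move=> t /andP[t1 t2]; rewrite frac_sum_moebius_terms //.
apply: (@maier_matrix R a h q ha hb q0 x x0 hA B (expR t)) => //; first exact: expR_gt0.
- exact: modulus_window_fit x0 z0 hz2 hL3 hu2 e1 (ltW u0) (ltW e0) hq t2.
- exact: ltW.
rewrite leNgt; apply/negP => tD; apply: notII; exists (expR t); split; last exact: ltW.
by rewrite powR_expR // ler_expR.
Qed.
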